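(* Let $n,m\geq 1$ and let $u=(u^1,\dots,u^m):\mathbb{R}^n\to\mathbb{R}^m$ be a smooth map such that the matrix $g_{ij}=\delta_{ij}-\sum_{\alpha=1}^m u^\alpha_iu^\alpha_j$ is positive definite at every point of $\mathbb{R}^n$ (i.e. the graph of $u$ is space-like in pseudo-Euclidean space $\mathbb{R}^{n+m}$ with index $m$), and such that on all of $\mathbb{R}^n$ $$\sum_{i,j=1}^n g^{ij}u^{\alpha}_{ij}=-u^{\alpha}+x\cdot Du^{\alpha},\qquad \alpha=1,\dots,m,$$ where $(g^{ij})=(g_{ij})^{-1}$. If the eigenvalues of the matrix $(g_{ij}(x))$ have a positive lower bound independent of $x\in\mathbb{R}^n$, then the graph $M=\{(x,u(x)):x\in\mathbb{R}^n\}$ is a linear subspace of $\mathbb{R}^{n+m}$.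
   Context: Notation: $u^\alpha_i=\partial u^\alpha/\partial x_i$, $u^\alpha_{ij}=\partial^2u^\alpha/\partial x_i\partial x_j$, $Du^\alpha=(u^\alpha_1,\dots,u^\alpha_n)$, $\cdot$ is the standard inner product on $\mathbb{R}^n$. The pseudo-Euclidean metric of index $m$ on $\mathbb{R}^{n+m}$ is $ds^2=\sum_{i=1}^n dx_i^2-\sum_{\alpha=1}^m dx_{n+\alpha}^2$, and $(g_{ij})$ is the induced metric on the graph. The system says that the space-like graph $M$ satisfies the self-shrinker equation $H=-X^N$. *)

(* Defs.v *)
From HB Require Import structures.
From mathcomp Require Import all_boot all_order all_algebra.
From mathcomp Require Import all_classical all_reals all_analysis.
Set Implicit Arguments.
Unset Strict Implicit.
Unset Printing Implicit Defensive.
Import Order.TTheory GRing.Theory Num.Theory.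
Import numFieldNormedType.Exports.
Local Open Scope classical_set_scope.
Local Open Scope ring_scope.

(* Points of R^n are row vectors; the i-th partial derivative is the
   directional derivative along the i-th standard basis vector. *)
Definition partial (R : realType) (n : nat) (i : 'I_n)
    (f : 'rV[R]_n -> R) : 'rV[R]_n -> R :=
  fun x => 'D_(delta_mx 0 i) f x.

(* [partials [:: i1; ...; ik] f] is d_{i1} (... (d_{ik} f)). *)
Definition partials (R : realType) (n : nat) (s : seq 'I_n)
    (f : 'rV[R]_n -> R) : 'rV[R]_n -> R :=
  foldr (@partial R n) f s.

(* C^oo: the iterated partial derivatives of all orders exist and are
   continuous everywhere.  Existence is required separately because
   ['D_v f x] is a total operator. *)
Definition smooth_fun (R : realType) (n : nat) (f : 'rV[R]_n -> R) : Prop :=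
  forall s : seq 'I_n,
    continuous (partials s f) /\
    forall (x : 'rV[R]_n) (i : 'I_n),
      derivable (partials s f) x (delta_mx 0 i).

Definition component (R : realType) (n m : nat)
    (u : 'rV[R]_n -> 'rV[R]_m) (a : 'I_m) : 'rV[R]_n -> R :=
  fun x => u x 0 a.

Definition smooth_map (R : realType) (n m : nat)
    (u : 'rV[R]_n -> 'rV[R]_m) : Prop :=
  forall a : 'I_m, smooth_fun (component u a).

Definition gradient (R : realType) (n : nat) (f : 'rV[R]_n -> R)
    (x : 'rV[R]_n) : 'rV[R]_n :=
  \row_i partial i f x.

Definition dotp (R : realType) (n : nat) (x y : 'rV[R]_n) : R :=
  \sum_(i < n) x 0 i * y 0 i.

(* The metric induced on the graph of u by
   sum_i dx_i^2 - sum_a dx_(n+a)^2, in the coordinates x of the base. *)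
Definition graph_metric (R : realType) (n m : nat)
    (u : 'rV[R]_n -> 'rV[R]_m) (x : 'rV[R]_n) : 'M[R]_n :=
  \matrix_(i, j) ((i == j)%:R -
    \sum_(a < m) partial i (component u a) x * partial j (component u a) x).

Definition posdefmx (R : realType) (n : nat) (A : 'M[R]_n) : Prop :=
  A^T = A /\ forall v : 'rV[R]_n, v != 0 -> 0 < (v *m A *m v^T) 0 0.

Definition graph_of (R : realType) (n m : nat)
    (u : 'rV[R]_n -> 'rV[R]_m) : set 'rV[R]_(n + m) :=
  [set row_mx x (u x) | x in [set: 'rV[R]_n]].

(* Main.v *)
(** With L f = sum_ij g^{ij} f_ij - x.Df the system reads L u = -u.  Write
    G = g^{-1}, P = (u^a_k)_{ka}, U_s = (u^a_{ks})_{ka} and M_s = U_s P^T.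
    Differentiating the system and using (M_s)_{kl} = (M_k)_{sl}, the terms of
    indefinite sign cancel and
      L G = 2 G (sum_st g^{st} (M_s G M_t^T + M_s^T G M_t + U_s U_t^T)) G,
    so every diagonal entry g^{kk} satisfies L g^{kk} >= 0; it is bounded by
    the inverse of the lower bound on the eigenvalues.  The drift -x.D is
    confining: |x|^2 is a strict supersolution off a ball, whence bounded
    subsolutions of L are constant.  Thus L g^{kk} = 0, which forces U_s = 0;
    then Du is constant and the system itself gives u(x) = x.Du(0). *)

Require Import Defs.
From mathcomp Require Import all_boot all_order all_algebra.
From mathcomp Require Import ring lra.
From mathcomp Require Import all_classical all_reals all_analysis.
Import Order.TTheory GRing.Theory Num.Theory.
Import numFieldNormedType.Exports.
Local Open Scope classical_set_scope.
Local Open Scope ring_scope.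

Set Implicit Arguments.
Unset Strict Implicit.
Unset Printing Implicit Defensive.

(** * Directional derivatives and C^1 functions *)

Section directional_derivatives.
Variables (R : realType) (V : normedModType R).
Implicit Types (f df : V -> R) (x v w : V) (t l : R).

(** The metric is bounded from two sides for different purposes. Since g = 1 - P P^T <= 1, always G
    >= 1: this ellipticity makes a Gaussian bump a strict subsolution away from its centre. The
    assumed bound c on the eigenvalues gives tr G <= n/c, which fixes the radius beyond which |x|^2
    is a supersolution. The bump replaces a separate strong maximum principle: one comparison yields
    f x <= f y for every pair of points. The entries g^{kk} can be differentiated from the inverse
    alone, without determinants or logarithms, and each k yields one row of G U_s = 0. Smoothness is
    given through iterated partials only, so derivatives in all directions and the symmetry of mixed
    ones are first derived from the continuity of the partials. *)

Lemma is_derive_lineP f x v t l :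
  is_derive (t *: v + x) v f l <->
  is_derive t 1 (fun h : R => f (h *: v + x)) l.
Proof.
suff E : (fun h : R => h^-1 *: ((f \o shift (t *: v + x)) (h *: v)
      - f (t *: v + x))) =
    (fun h : R => h^-1 *: (((fun h : R => f (h *: v + x)) \o shift t) (h *: 1)
      - f (t *: v + x))).
  by split=> -[d dl]; split; move: d dl; rewrite /derivable /derive E.
by apply/funext => h /=; rewrite addrA -scalerDl [_%:A]mulr1.
Qed.

(** Clearing the denominator [h] gives an estimate that also holds at h = 0 and is ready for the
    triangle inequality. *)
Lemma is_deriveP f x v l :
  is_derive x v f l <-> forall e : R, 0 < e -> exists2 d : R, 0 < d &
    forall h : R, `|h| < d -> `|f (h *: v + x) - f x - h * l| <= e * `|h|.
Proof.
split=> [[dfx dl] e e0|H].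
  have /cvgrPdist_le/(_ e e0) [d /= d0 H] : (fun h : R =>
      h^-1 *: ((f \o shift x) (h *: v) - f x)) @ 0^' --> l.
    by rewrite -dl; exact: dfx.
  exists d => // h hd; have [->|h0] := eqVneq h 0.
    by rewrite scale0r add0r subrr mul0r subrr normr0 mulr0.
  have /= := H h; rewrite sub0r normrN => /(_ hd h0).
  rewrite -(ler_pM2r (_ : 0 < `|h|)) ?normr_gt0// -normrM mulrBl mulrAC.
  by rewrite mulVf// mul1r distrC [l * h]mulrC.
have c : (fun h : R => h^-1 *: ((f \o shift x) (h *: v) - f x)) @ 0^' --> l.
  apply/cvgrPdist_le => e e0; have [d d0 Hd] := H e e0.
  exists d => // h; rewrite /ball_ /= sub0r normrN => hd h0.
  rewrite -(ler_pM2r (_ : 0 < `|h|)) ?normr_gt0// -normrM mulrBl mulrAC.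
  by rewrite mulVf// mul1r distrC [l * h]mulrC; exact: Hd.
by split; [apply/cvg_ex; exists l|exact: cvg_lim].
Qed.

Lemma continuousP_norm f x :
  {for x, continuous f} <-> forall e : R, 0 < e -> exists2 d : R, 0 < d &
    forall y, `|y - x| < d -> `|f y - f x| <= e.
Proof.
split=> [/cvgrPdist_le cf e e0|H].
  have /nbhs_normP[d /= d0 dH] := cf e e0; exists d => // y yd.
  by rewrite distrC; apply: dH; rewrite /= distrC.
apply/cvgrPdist_le => e e0; have [d d0 Hd] := H e e0.
apply/nbhs_normP; exists d => // y; rewrite /ball_ /= distrC => yd.
by rewrite distrC; exact: Hd.
Qed.

Lemma MVT_line f df v x (h : R) :
  (forall y, is_derive y v f (df y)) ->
  exists2 t : R, `|t| <= `|h| & f (h *: v + x) - f x = h * df (t *: v + x).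
Proof.
move=> fdf; pose g := fun s : R => f (s *: v + x).
have gdg (s : R) : is_derive s 1 g (df (s *: v + x)) by apply/is_derive_lineP.
have cg (s : R) : {for s, continuous g}.
  by apply: differentiable_continuous; apply/derivable1_diffP; have [] := gdg s.
have cW A : {within A, continuous g} by exact: continuous_subspaceT.
have g0 : g 0 = f x by rewrite /g scale0r add0r.
have [h0|h0] := leP 0 h.
- have [t + E] := MVT_segment h0 (fun s _ => gdg s) (cW _).
  rewrite in_itv/= => /andP[t0 th].
  by exists t; rewrite ?ger0_norm//; move: E; rewrite g0 subr0 mulrC.
- have [t + E] := MVT_segment (ltW h0) (fun s _ => gdg s) (cW _).
  rewrite in_itv/= => /andP[th t0].
  exists t; first by rewrite !ler0_norm ?lerN2// ltW.
  by rewrite -g0 -[LHS]opprB E sub0r mulrN opprK mulrC.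
Qed.

(* [f] need not be differentiable at [x]: only the derivative along [v] has to
   be continuous.  This is how C^1 functions get all directional derivatives. *)
Lemma is_derive_dirD f df v w x l :
  (forall y, is_derive y v f (df y)) -> {for x, continuous df} ->
  is_derive x w f l -> is_derive x (v + w) f (df x + l).
Proof.
move=> fdf /continuousP_norm cdf /is_deriveP dw; apply/is_deriveP => e e0.
have e2 : 0 < e / 2 by rewrite divr_gt0.
have [d1 d10 H1] := dw _ e2; have [d2 d20 H2] := cdf _ e2.
pose K := `|v| + `|w| + 1.
have K0 : 0 < K by rewrite ltr_wpDl// addr_ge0.
exists (Num.min d1 (d2 / K)); first by rewrite lt_min d10 divr_gt0.
move=> h; rewrite lt_min => /andP[hd1 hd2].
have [t th E] := MVT_line (h *: w + x) h fdf.
have -> : f (h *: (v + w) + x) - f x - h * (df x + l) =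
    h * (df (t *: v + (h *: w + x)) - df x) + (f (h *: w + x) - f x - h * l).
  by rewrite scalerDr -(addrA (h *: v)) mulrBr -E; ring.
apply: le_trans (ler_normD _ _) _; rewrite (splitr e) mulrDl lerD ?H1//.
rewrite normrM mulrC ler_wpM2r// H2// addrA addrK.
apply: le_lt_trans (ler_normD _ _) _; rewrite !normrZ.
apply: (@le_lt_trans _ _ (`|h| * K)); last by rewrite -ltr_pdivlMr.
rewrite /K !mulrDr mulr1 -addrA lerD// ?ler_wpM2r//.
by rewrite lerDl.
Qed.

Lemma is_derive_dirZ f v x (c : R) l :
  is_derive x v f l -> is_derive x (c *: v) f (c * l).
Proof.
move=> /is_deriveP H; apply/is_deriveP => e e0.
have c0 : 0 < `|c| + 1 by rewrite ltr_wpDl.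
have [d d0 Hd] := H (e / (`|c| + 1)) (divr_gt0 e0 c0).
exists (d / (`|c| + 1)); first exact: divr_gt0.
move=> h; rewrite ltr_pdivlMr// => hd.
have := Hd (h * c); rewrite scalerA mulrA normrM.
have -> : `|h| * `|c| < d.
  by apply: le_lt_trans hd; rewrite ler_wpM2l// lerDl.
move=> /(_ isT) /le_trans; apply.
rewrite -mulrA ler_wpM2l ?(ltW e0)// mulrC ler_pdivrMr//.
by rewrite ler_wpM2l// lerDl.
Qed.

(* Both mixed derivatives are limits of the same second difference quotient. *)
Lemma mixed_derivatives_swap f dv dw dvw dwv v w x :
  (forall y, is_derive y v f (dv y)) -> (forall y, is_derive y w f (dw y)) ->
  (forall y, is_derive y w dv (dwv y)) -> (forall y, is_derive y v dw (dvw y)) ->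
  {for x, continuous dwv} -> {for x, continuous dvw} -> dwv x = dvw x.
Proof.
move=> fv fw fwv fvw /continuousP_norm cwv /continuousP_norm cvw.
(* The second difference over the parallelogram on h v1 and h w1: the mean value theorem along v1 is
   applied to the increment of f1 in direction w1, then along w1 to d1. *)
have diff f1 d1 d21 v1 w1 (h : R) : (forall y, is_derive y v1 f1 (d1 y)) ->
    (forall y, is_derive y w1 d1 (d21 y)) -> exists s t : R,
    [/\ `|s| <= `|h|, `|t| <= `|h| & f1 (h *: v1 + h *: w1 + x) -
      f1 (h *: w1 + x) - f1 (h *: v1 + x) + f1 x =
      h * h * d21 (t *: w1 + (s *: v1 + x))].
  move=> fd1 d1d21.
  have D y : is_derive y v1 (fun y => f1 (y + h *: w1) - f1 y)
      (d1 (y + h *: w1) - d1 y).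
    apply: is_deriveB; apply/is_deriveP => e e0.
    have /is_deriveP/(_ e e0)[d d0 H] := fd1 (y + h *: w1).
    by exists d => // k kd; rewrite -(addrA (k *: v1)); exact: H.
  have [s sh E1] := MVT_line x h D.
  have [t th E2] := MVT_line (s *: v1 + x) h d1d21.
  exists s, t; split => //.
  rewrite -mulrA -E2 [h *: w1 + (_ + _)]addrC -E1 /=.
  rewrite [h *: v1 + x + _]addrAC [x + _]addrC; ring.
apply/eqP; rewrite -subr_eq0 -normr_le0; apply/ler_addgt0Pl => e e0.
rewrite addr0.
have e2 : 0 < e / 2 by rewrite divr_gt0.
have [d1 d10 H1] := cwv _ e2; have [d2 d20 H2] := cvw _ e2.
pose K := `|v| + `|w| + 1.
have K0 : 0 < K by rewrite ltr_wpDl// addr_ge0.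
have m0 : 0 < Num.min d1 d2 by rewrite lt_min d10.
pose h := Num.min d1 d2 / K / 2.
have h0 : 0 < h by rewrite !divr_gt0.
have hK : h * K < Num.min d1 d2.
  rewrite /h mulrAC divfK ?gt_eqF//; rewrite ltr_pdivrMr//.
  by rewrite ltr_pMr// ltr1n.
have [s1 [t1 [s1h t1h E1]]] := diff _ _ _ v w h fv fwv.
have [s2 [t2 [s2h t2h E2]]] := diff _ _ _ w v h fw fvw.
have EE : dwv (t1 *: w + (s1 *: v + x)) = dvw (t2 *: v + (s2 *: w + x)).
  apply: (mulfI (_ : h * h != 0)); first by rewrite mulf_neq0 ?gt_eqF.
  rewrite -E1 -E2 [h *: w + h *: v]addrC; ring.
have -> : dwv x - dvw x = (dvw (t2 *: v + (s2 *: w + x)) - dvw x) -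
    (dwv (t1 *: w + (s1 *: v + x)) - dwv x) by rewrite EE; ring.
have small (s t : R) : `|s| <= `|h| -> `|t| <= `|h| ->
    `|s *: v + t *: w| < Num.min d1 d2.
  move=> sh th; apply: le_lt_trans hK; apply: le_trans (ler_normD _ _) _.
  rewrite !normrZ /K !mulrDr mulr1 -[h in leRHS]gtr0_norm//.
  rewrite -[leLHS]addr0 lerD// lerD// ?ler_wpM2r//.
apply: le_trans (ler_normB _ _) _; rewrite (splitr e) lerD//.
- apply: H2; rewrite !addrA addrK.
  by apply: lt_le_trans (small _ _ t2h s2h) _; rewrite ge_min lexx orbT.
- apply: H1; rewrite !addrA addrK addrC.
  by apply: lt_le_trans (small _ _ s1h t1h) _; rewrite ge_min lexx.
Qed.

End directional_derivatives.

(** If l > 0, then [df], which vanishes at 0, would be positive just to the right of 0, and the mean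
    value theorem would produce a value above f 0. *)
Lemma second_derivative_at_max (R : realType) (f df : R -> R) (l : R) :
  (forall t : R, is_derive t 1 f (df t)) -> is_derive (0 : R) 1 df l ->
  (forall t, f t <= f 0) -> df 0 = 0 /\ l <= 0.
Proof.
move=> fdf /is_deriveP dl fmax.
have df0 : df 0 = 0.
  have [] : is_derive (0 : R) 1 f 0.
    apply: (@derive1_at_max R f (-1) 1 0); last 1 first.
    - by move=> t _.
    - exact: le_trans (lerN10 R) ler01.
    - by move=> t _; have [] := fdf t.
    by rewrite in_itv/= ltrN10 ltr01.
  by move=> _; have [_ ->] := fdf 0.
split=> //; rewrite leNgt; apply/negP => l0.
have [d d0 H] := dl (l / 2) (divr_gt0 l0 (ltr0Sn _ 1)).
have cf : {within `[0, d / 2], continuous f}.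
  apply: continuous_subspaceT => t.
  by apply: differentiable_continuous; apply/derivable1_diffP; have [] := fdf t.
have d20 : 0 < d / 2 by rewrite divr_gt0.
have [c] := MVT d20 (fun t _ => fdf t) cf.
rewrite in_itv/= => /andP[c0 cd] E.
have cltd : `|c| < d by rewrite gtr0_norm//; lra.
have := H c cltd; rewrite [_%:A]mulr1 addr0 df0 subr0 (gtr0_norm c0) ler_norml.
move=> /andP[lo _].
have dfc : 0 < df c.
  have : 0 < l * c by rewrite mulr_gt0.
  by lra.
by have := fmax (d / 2); rewrite leNgt -subr_gt0 E subr0 mulr_gt0.
Qed.

(** C^1 with a named gradient: the calculus rules below then compute derivatives as explicit
    formulas, and a further [has_grad] for each [df i] expresses C^2, with [ddf i j] differentiated
    along i first and then j. *)
Definition has_grad (R : realType) (n : nat) (f : 'rV[R]_n -> R)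
    (df : 'I_n -> 'rV[R]_n -> R) : Prop :=
  continuous f /\ forall i, continuous (df i) /\
    forall x, is_derive x (delta_mx 0 i) f (df i x).

Section gradients.
Variables (R : realType) (n : nat).
Implicit Types (f g : 'rV[R]_n -> R) (df dg : 'I_n -> 'rV[R]_n -> R).
Implicit Types (x y v : 'rV[R]_n).

Lemma has_grad_partials f s : smooth_fun f ->
  has_grad (partials s f) (fun i => partials (i :: s) f).
Proof.
move=> sf; have [cs ds] := sf s; split=> // i; split; first by case: (sf (i :: s)).
by move=> x; apply: derivableP; exact: ds.
Qed.

Lemma has_grad_partial f df i : has_grad f df -> partial i f = df i.
Proof. by move=> [_ /(_ i)[_ H]]; apply/funext => x; have [] := H x. Qed.

(** The direction v is built up one basis vector at a time; [is_derive_dirD] adds each new one using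
    the continuity of the corresponding partial. *)
Lemma has_grad_dir f df : has_grad f df ->
  forall x v, is_derive x v f (\sum_i v 0 i * df i x).
Proof.
move=> [cf fdf] x v; rewrite [v in is_derive _ v]row_sum_delta.
elim: (index_enum _) => [|i r IH].
  by rewrite !big_nil; exact: is_derive0.
rewrite !big_cons.
apply: (@is_derive_dirD _ _ f (fun y => v 0 i * df i y)) IH.
- by move=> y; apply: is_derive_dirZ; case: (fdf i).
- by have [cdf _] := fdf i; exact: cvgM (cvg_cst _) (cdf x).
Qed.

Lemma has_grad_sym f df ddf i j x : has_grad f df ->
  (forall k, has_grad (df k) (ddf k)) -> ddf i j x = ddf j i x.
Proof.
move=> [_ H] H2; apply: (@mixed_derivatives_swap _ _ f (df i) (df j) _ _
  (delta_mx 0 i) (delta_mx 0 j)).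
- by case: (H i).
- by case: (H j).
- by case: (H2 i) => _ /(_ j)[].
- by case: (H2 j) => _ /(_ i)[].
- by case: (H2 i) => _ /(_ j)[+ _]; apply.
- by case: (H2 j) => _ /(_ i)[+ _]; apply.
Qed.

Lemma has_grad_max f df ddf x : has_grad f df ->
  (forall k, has_grad (df k) (ddf k)) -> (forall y, f y <= f x) ->
  (forall i, df i x = 0) /\
  (forall v, \sum_i \sum_j v 0 i * v 0 j * ddf i j x <= 0).
Proof.
move=> H H2 fmax.
have L v : \sum_i v 0 i * df i x = 0 /\
    \sum_i \sum_j v 0 i * v 0 j * ddf i j x <= 0.
  have := @second_derivative_at_max _ (fun t => f (t *: v + x))
    (fun t => \sum_i v 0 i * df i (t *: v + x))
    (\sum_i \sum_j v 0 i * v 0 j * ddf i j x).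
  rewrite !scale0r !add0r; apply; last by move=> t; exact: fmax.
    by move=> t; exact: ((is_derive_lineP f x v t _).1 (has_grad_dir H _ v)).
  have -> : (fun t => \sum_i v 0 i * df i (t *: v + x)) =
      \sum_i (fun t => v 0 i * df i (t *: v + x)).
    by apply/funext => t; rewrite fct_sumE.
  apply: is_derive_sum => i.
  have := is_deriveZ (v 0 i) ((is_derive_lineP (df i) x v 0 _).1
    (has_grad_dir (H2 i) (0 *: v + x) v)).
  rewrite scale0r add0r => D.
  apply: (is_derive_eq D); rewrite /GRing.scale/= mulr_sumr.
  by apply: eq_bigr => j _; rewrite mulrA.
split=> [i|v]; last by case: (L v).
have [+ _] := L (delta_mx 0 i); rewrite (bigD1 i)//= big1.
  by rewrite !mxE !eqxx mul1r addr0.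
by move=> j /negbTE ji; rewrite !mxE ji mul0r.
Qed.

Lemma has_grad_eq f g df dg : has_grad f df -> f =1 g ->
  (forall i, df i =1 dg i) -> has_grad g dg.
Proof.
move=> H /funext <- E; have <- // : df = dg.
by apply/funext => i; apply/funext.
Qed.

Lemma has_grad_cst (c : R) : has_grad (fun=> c) (fun _ (_ : 'rV[R]_n) => 0).
Proof.
split=> [x|i]; first exact: cst_continuous.
split=> [x|x]; first exact: cst_continuous.
exact: is_derive_cst.
Qed.

Lemma has_grad_coord (k : 'I_n) :
  has_grad (fun x => x 0 k) (fun i (_ : 'rV[R]_n) => (i == k)%:R).
Proof.
split=> [|i]; first exact: coord_continuous.
split=> [x|x]; first exact: cst_continuous.
apply/is_deriveP => e e0; exists 1 => // h _; rewrite !mxE eqxx/=.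
by rewrite addrK eq_sym subrr normr0 mulr_ge0// ltW.
Qed.

Lemma has_gradD f g df dg : has_grad f df -> has_grad g dg ->
  has_grad (fun x => f x + g x) (fun i x => df i x + dg i x).
Proof.
move=> [cf Hf] [cg Hg]; split=> [x|i]; first exact: cvgD (cf x) (cg x).
have [cdf df'] := Hf i; have [cdg dg'] := Hg i.
by split=> x; [exact: cvgD (cdf x) (cdg x)|exact: is_deriveD].
Qed.

Lemma has_gradM f g df dg : has_grad f df -> has_grad g dg ->
  has_grad (fun x => f x * g x) (fun i x => df i x * g x + f x * dg i x).
Proof.
move=> [cf Hf] [cg Hg]; split=> [x|i]; first exact: cvgM (cf x) (cg x).
have [cdf df'] := Hf i; have [cdg dg'] := Hg i; split=> x.
  exact: (cvgD (cvgM (cdf x) (cg x)) (cvgM (cf x) (cdg x))).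
apply: (is_derive_eq (is_deriveM (df' x) (dg' x))).
by rewrite addrC /GRing.scale/= [g x * _]mulrC.
Qed.

Lemma has_gradZ c f df : has_grad f df ->
  has_grad (fun x => c * f x) (fun i x => c * df i x).
Proof.
move=> Hf; apply: (has_grad_eq (has_gradM (has_grad_cst c) Hf)) => // i x.
by rewrite mul0r add0r.
Qed.

Lemma has_grad_sum (I : Type) (r : seq I) (F : I -> 'rV[R]_n -> R)
    (dF : I -> 'I_n -> 'rV[R]_n -> R) :
  (forall k, has_grad (F k) (dF k)) ->
  has_grad (fun x => \sum_(k <- r) F k x) (fun i x => \sum_(k <- r) dF k i x).
Proof.
move=> H; elim: r => [|k r IH].
  by apply: (has_grad_eq (has_grad_cst 0)) => [x|i x]; rewrite big_nil.
by apply: (has_grad_eq (has_gradD (H k) IH)) => [x|i x]; rewrite big_cons.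
Qed.

Lemma has_grad_expR f df : has_grad f df ->
  has_grad (fun x => expR (f x)) (fun i x => df i x * expR (f x)).
Proof.
move=> [cf Hf].
have ce : continuous (fun x => expR (f x)).
  by move=> x; apply: (continuous_comp (cf x)); exact: continuous_expR.
split=> // i; have [cdf df'] := Hf i; split=> x.
  exact: cvgM (cdf x) (ce x).
set v : 'rV[R]_n := delta_mx 0 i.
have := (is_derive_lineP f x v 0 (df i x)).1; rewrite scale0r add0r => D.
have := (is_derive_lineP (fun x => expR (f x)) x v 0 (df i x * expR (f x))).2.
rewrite scale0r add0r; apply.
have := @is_derive1_comp _ expR (fun h => f (h *: v + x)) 0 _ _
  (is_derive_expR _) (D (df' x)).
by rewrite scale0r add0r mulrC.
Qed.

Lemma has_grad0_cst f df : has_grad f df -> (forall i x, df i x = 0) ->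
  forall x y, f x = f y.
Proof.
move=> H df0 x y.
have D z : is_derive z (x - y) f 0.
  by have := has_grad_dir H z (x - y); rewrite big1// => i _; rewrite df0 mulr0.
have [t _] := MVT_line y 1 D.
by rewrite mulr0 scale1r subrK => /eqP; rewrite subr_eq0 => /eqP.
Qed.

End gradients.

(** * Quadratic forms *)

Definition bform (R : nzRingType) (n : nat) (A : 'M[R]_n) (u v : 'rV[R]_n) : R :=
  (u *m A *m v^T) 0 0.

Definition psdmx (R : realType) (n : nat) (A : 'M[R]_n) : Prop :=
  A^T = A /\ forall v : 'rV[R]_n, 0 <= bform A v v.

Lemma dotp_ge0 (R : realType) n (u : 'rV[R]_n) : 0 <= dotp u u.
Proof. by apply: sumr_ge0 => i _; rewrite -expr2 sqr_ge0. Qed.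

Lemma le_sqr_dotp (R : realType) n (u : 'rV[R]_n) i : u 0 i ^+ 2 <= dotp u u.
Proof.
rewrite /dotp (bigD1 i)//= -expr2 lerDl.
by apply: sumr_ge0 => j _; rewrite -expr2 sqr_ge0.
Qed.

Lemma dotp_eq0 (R : realType) n (u : 'rV[R]_n) : dotp u u = 0 -> u = 0.
Proof.
move=> u0; apply/rowP => i; rewrite mxE; apply/eqP.
by rewrite -sqrf_eq0 eq_le sqr_ge0 andbT -u0 le_sqr_dotp.
Qed.

Section quadratic_forms.
Variables (R : realType) (n : nat).
Implicit Types (A C : 'M[R]_n) (u v w : 'rV[R]_n).

Lemma bformDl A u v w : bform A (u + v) w = bform A u w + bform A v w.
Proof. by rewrite /bform !mulmxDl mxE. Qed.

Lemma bformDr A u v w : bform A w (u + v) = bform A w u + bform A w v.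
Proof. by rewrite /bform linearD/= mulmxDr mxE. Qed.

Lemma bformZl A c u v : bform A (c *: u) v = c * bform A u v.
Proof. by rewrite /bform -!scalemxAl mxE. Qed.

Lemma bformZr A c u v : bform A u (c *: v) = c * bform A u v.
Proof. by rewrite /bform linearZ/= -scalemxAr mxE. Qed.

Lemma bform_deltar A u i : bform A u (delta_mx 0 i) = (u *m A) 0 i.
Proof. by rewrite /bform trmx_delta -colE mxE. Qed.

Lemma bform_sym A u v : A^T = A -> bform A u v = bform A v u.
Proof.
move=> As; rewrite /bform -[in LHS](trmxK (u *m A *m v^T)) mxE.
by rewrite !trmx_mul trmxK As mulmxA.
Qed.

Lemma bformB A C u v : bform (A - C) u v = bform A u v - bform C u v.
Proof. by rewrite /bform mulmxBr mulmxBl !mxE. Qed.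

Lemma bform_dotp A u v : bform A u v = dotp (u *m A) v.
Proof. by rewrite /bform mxE; apply: eq_bigr => i _; rewrite [X in _ * X]mxE. Qed.

Lemma bform_scalar c u v : bform c%:M u v = c * dotp u v.
Proof.
rewrite bform_dotp mul_mx_scalar /dotp mulr_sumr.
by apply: eq_bigr => i _; rewrite mxE mulrA.
Qed.

Lemma psdmx_null A w : psdmx A -> bform A w w = 0 -> w *m A = 0.
Proof.
move=> [As Ap] w0; apply/rowP => i; rewrite [RHS]mxE -bform_deltar.
set v := delta_mx 0 i; set s := bform A w v.
have H t : 0 <= 2 * t * s + t ^+ 2 * bform A v v.
  have := Ap (w + t *: v).
  rewrite !(bformDl, bformDr, bformZl, bformZr) w0 (bform_sym v w As) -/s.
  by move=> h; lra.
apply/eqP; rewrite -sqrf_eq0 eq_le sqr_ge0 andbT.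
have v0 : 0 <= bform A v v := Ap v.
(* Near the minimiser -s/q of the quadratic in [H]; the + 1 covers q = 0 and still makes the value
   negative unless s = 0. *)
have := H (- s / (bform A v v + 1)).
set q := bform A v v in v0 *; have q1 : 0 < q + 1 by rewrite ltr_wpDl.
have -> : 2 * (- s / (q + 1)) * s + (- s / (q + 1)) ^+ 2 * q =
    - (s ^+ 2 * ((q + 2) / (q + 1) ^+ 2)).
  by field; rewrite gt_eqF.
rewrite oppr_ge0 pmulr_lle0// divr_gt0 ?exprn_gt0//.
by rewrite (lt_le_trans q1)// lerD2l ler1n.
Qed.

(* Subtracting (A e)(A e)^T / (e A e) from A keeps it positive semidefinite and
   clears the row of the basis vector e. *)
Lemma psdmx_sum_squares A : psdmx A ->
  exists r : seq 'rV[R]_n, A = \sum_(b <- r) b^T *m b.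
Proof.
(* Induction on the number of leading rows that may be nonzero; k = n puts no condition on [A]. *)
suff H k : forall A, psdmx A -> (forall i j : 'I_n, (k <= i)%N -> A i j = 0) ->
    exists r : seq 'rV[R]_n, A = \sum_(b <- r) b^T *m b.
  by move=> Ap; apply: (H n) => // i j; rewrite leqNgt ltn_ord.
elim: k => [|k IH] {}A Ap A0.
  exists [::]; rewrite big_nil; apply/matrixP => i j.
  by rewrite A0// mxE.
have [nk|kn] := leqP n k.
  by apply: IH => // i j /(leq_trans nk); rewrite leqNgt ltn_ord.
pose i := Ordinal kn; pose e : 'rV[R]_n := delta_mx 0 i.
have [As Apos] := Ap.
have rowA : e *m A = row i A by rewrite rowE.
have eAe : bform A e e = A i i by rewrite bform_deltar rowA mxE.
have := Apos e; rewrite eAe le_eqVlt => /predU1P[/esym a0|a0].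
  have /rowP r0 : e *m A = 0 by apply: psdmx_null; rewrite ?eAe.
  apply: IH => // l j; rewrite leq_eqVlt => /predU1P[kl|/A0//].
  have -> : l = i by apply: val_inj.
  by have := r0 j; rewrite rowA !mxE.
set a := A i i in a0 eAe *.
pose b : 'rV[R]_n := (Num.sqrt a)^-1 *: row i A.
have bb l j : (b^T *m b) l j = A i l * A i j / a.
  rewrite !mxE big_ord1 !mxE -{3}(sqr_sqrtr (ltW a0)).
  by field; rewrite sqrtr_eq0 -ltNge.
have vb v : bform (b^T *m b) v v = bform A v e ^+ 2 / a.
  rewrite /bform mulmxA -mulmxA; set m := v *m b^T.
  have -> : b *m v^T = m^T by rewrite /m trmx_mul trmxK.
  rewrite mxE big_ord1 [m^T _ _]mxE -expr2 /m /b linearZ/= -scalemxAr mxE exprMn exprVn.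
  rewrite sqr_sqrtr ?ltW// mulrC; congr (_ ^+ 2 / a).
  by rewrite -rowA trmx_mul As mulmxA.
have [//||r rE] := IH (A - b^T *m b).
- split; first by rewrite linearB/= trmx_mul trmxK As.
  move=> v; rewrite bformB vb.
  (* The form of [A] at v made A-orthogonal to e is exactly the form of A - b^T b at v. *)
  have := Apos (v + (- (bform A v e / a)) *: e).
  rewrite !(bformDl, bformDr, bformZl, bformZr) (bform_sym e v As) eAe.
  move=> /le_trans; apply; rewrite le_eqVlt; apply/orP; left; apply/eqP.
  by field; rewrite gt_eqF.
- move=> l j kl; rewrite mxE [X in _ + X]mxE bb.
  have [->|li] := eqVneq l i; first by rewrite -/a mulrAC divff ?gt_eqF// mul1r subrr.
  have kl' : (k < l)%N by rewrite ltn_neqAle kl andbT eq_sym; exact: li.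
  have Ail : A i l = 0 by rewrite -As mxE A0.
  by rewrite (A0 l j)// Ail !mul0r subr0.
exists (b :: r); by rewrite big_cons -rE addrC subrK.
Qed.

Lemma mxtrace_outer u C : \tr (u^T *m u *m C) = bform C u u.
Proof. by rewrite -mulmxA mxtrace_mulC /bform /mxtrace big_ord1. Qed.

Lemma mxtrace_psdM A C : psdmx A -> (forall v, 0 <= bform C v v) ->
  0 <= \tr (A *m C).
Proof.
move=> /psdmx_sum_squares[r ->] C0; rewrite mulmx_suml raddf_sum/=.
by apply: sumr_ge0 => b _; rewrite mxtrace_outer.
Qed.

Lemma mxtrace_psd_sandwich q A (K : 'M[R]_q) (Z : 'M[R]_(n, q)) :
  psdmx A -> psdmx K -> 0 <= \tr (A *m (Z *m K *m Z^T)).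
Proof.
move=> Ap [_ K0]; apply: mxtrace_psdM => // v.
have -> : bform (Z *m K *m Z^T) v v = bform K (v *m Z) (v *m Z).
  by rewrite /bform trmx_mul !mulmxA.
exact: K0.
Qed.

Lemma posdefmx_psd A : posdefmx A -> psdmx A.
Proof.
move=> [As Ap]; split=> // v; have [->|/Ap/ltW//] := eqVneq v 0.
by rewrite /bform !mul0mx mxE.
Qed.

(** The trace is the sum of the form of [A] over the columns of [V]; all summands are non-negative,
    so each is zero and definiteness kills each column. *)
Lemma mxtrace_gram_eq0 m A (V : 'M[R]_(n, m)) : posdefmx A ->
  \tr (A *m (V *m V^T)) = 0 -> V = 0.
Proof.
move=> Ad; have [_ A0] := posdefmx_psd Ad.
have -> : \tr (A *m (V *m V^T)) = \sum_j bform A (col j V)^T (col j V)^T.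
  rewrite mulmxA mxtrace_mulC mulmxA; apply: eq_bigr => j _.
  rewrite /bform trmxK tr_col -row_mul [LHS]mxE [RHS]mxE.
  by apply: eq_bigr => k _; rewrite [row _ _ _ _]mxE [col _ _ _ _]mxE.
move=> /eqP; rewrite psumr_eq0 => [/allP V0|j _]; last exact: A0.
apply/matrixP => i j; have /eqP q0 := V0 j (mem_index_enum j).
have [c0|/(Ad.2)] := eqVneq (col j V)^T 0.
  by move/rowP/(_ i): c0; rewrite !mxE.
by rewrite -/(bform _ _ _) q0 ltxx.
Qed.

Lemma posdefmx_unit A : posdefmx A -> A \in unitmx.
Proof.
move=> [_ Ap]; rewrite -row_free_unit -kermx_eq0; apply/eqP/row_matrixP => i.
rewrite row0; apply/eqP/negPn/negP => /Ap.
by rewrite -row_mul mulmx_ker row0 mul0mx mxE ltxx.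
Qed.

(* The minimum of the form on the unit sphere is an eigenvalue. *)
Lemma psdmx_ge_eigenvalues A (c : R) : (0 < n)%N -> A^T = A ->
  (forall l, eigenvalue A l -> c <= l) -> forall v, c * dotp v v <= bform A v v.
Proof.
move=> n0 As eig.
pose i0 := Ordinal n0; pose e : 'rV[R]_n := delta_mx 0 i0.
have cdot : continuous (fun v : 'rV[R]_n => dotp v v).
  have [] // := has_grad_sum (index_enum 'I_n)
    (fun k => has_gradM (has_grad_coord R k) (has_grad_coord R k)).
have cform : continuous (fun v : 'rV[R]_n => bform A v v).
  have -> : (fun v : 'rV[R]_n => bform A v v) =
      (fun v => \sum_i \sum_j A j i * v 0 j * v 0 i).
    apply/funext => v; rewrite bform_dotp; apply: eq_bigr => i _.
    by rewrite mxE mulr_suml; apply: eq_bigr => j _; rewrite [A j i * _]mulrC.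
  have [] // := has_grad_sum (index_enum 'I_n) (fun i =>
    has_grad_sum (index_enum 'I_n) (fun j => has_gradM
      (has_gradZ (A j i) (has_grad_coord R j)) (has_grad_coord R i))).
pose S := [set v : 'rV[R]_n | dotp v v = 1].
have S0 : S !=set0.
  exists e; rewrite /S/= /dotp (bigD1 i0)//= big1 ?addr0.
    by rewrite !mxE !eqxx mulr1.
  by move=> j /negbTE ji; rewrite !mxE ji mul0r.
have cS : compact S.
  apply: bounded_closed_compact.
    exists 1; split=> // M M1 v Sv; apply: le_trans (ltW M1).
    rewrite /Num.norm/= mx_normrE; apply: bigmax_le => // -[i j] _ /=.
    rewrite ord1 -(@ler_pXn2r _ 2)// ?nnegrE// expr1n -normrX ger0_norm ?sqr_ge0//.
    by rewrite -Sv le_sqr_dotp.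
  by have := closed_comp (fun x _ => cdot x) (@closed_eq _ 1).
have [w wS wmin] := EVT_min_rV S0 cS (continuous_subspaceT cform).
have ww : dotp w w = 1 by move: wS; rewrite inE.
set mu := bform A w w in wmin.
have Amu v : mu * dotp v v <= bform A v v.
  have [->|v0] := eqVneq v 0.
    by rewrite /bform !mul0mx mxE /dotp big1 ?mulr0// => i _; rewrite mxE mul0r.
  have d0 : 0 < dotp v v.
    by rewrite lt_def dotp_ge0 andbT; apply: contra_neq v0; exact: dotp_eq0.
  have := wmin ((Num.sqrt (dotp v v))^-1 *: v).
  have scal : (Num.sqrt (dotp v v))^-1 * (Num.sqrt (dotp v v))^-1 = (dotp v v)^-1.
    by rewrite -invfM -expr2 sqr_sqrtr ?ltW.
  rewrite bformZl bformZr mulrA scal mulrC ler_pdivlMr//; apply.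
  rewrite inE /S/=; rewrite -[LHS]mul1r -bform_scalar bformZl bformZr mulrA scal.
  by rewrite bform_scalar mul1r mulVf ?gt_eqF.
(* The minimiser is a null vector of the positive semidefinite A - mu, hence in its kernel; this
   replaces a Lagrange multiplier. *)
have wA : w *m (A - mu%:M) = 0.
  apply: psdmx_null; last by rewrite bformB bform_scalar ww mulr1 subrr.
  split; first by rewrite linearB/= As tr_scalar_mx.
  by move=> v; rewrite bformB bform_scalar subr_ge0.
have cmu : c <= mu.
  apply: eig; apply/eigenvalueP; exists w.
    by apply/eqP; rewrite -subr_eq0 -mul_mx_scalar -mulmxBr wA.
  apply/eqP => w0; have /eqP := ww; rewrite w0 /dotp big1 => [|i _].
    by rewrite eq_sym oner_eq0.
  by rewrite mxE mul0r.
by move=> v; apply: le_trans (Amu v); rewrite ler_wpM2r ?dotp_ge0.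
Qed.

Lemma invmx_sym A : A^T = A -> (invmx A)^T = invmx A.
Proof. by move=> As; rewrite trmx_inv As. Qed.

(** Expand the form of [A] at v - v A^-1, which is non-negative: the cross term is -2 v.v and the
    last square is the form of A^-1. *)
Lemma invmx_form_ge A : posdefmx A -> (forall v, bform A v v <= dotp v v) ->
  forall v, dotp v v <= bform (invmx A) v v.
Proof.
move=> Ad A1 v; have [As Ap] := posdefmx_psd Ad.
have Au := posdefmx_unit Ad.
have := Ap (v - v *m invmx A).
have GA : bform A (v *m invmx A) v = dotp v v.
  by rewrite bform_dotp mulmxKV.
have GAG : bform A (v *m invmx A) (v *m invmx A) = bform (invmx A) v v.
  by rewrite [in LHS]bform_dotp mulmxKV// bform_sym ?invmx_sym// bform_dotp /dotp;
     apply: eq_bigr => i _; rewrite mulrC.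
rewrite -[- _]scaleN1r !(bformDl, bformDr, bformZl, bformZr) GAG.
rewrite (bform_sym v _ As) GA.
have := A1 v; lra.
Qed.

(** With w = v A^-1, the hypothesis at w reads c |w|^2 <= w.v; inserting it in |v - c w|^2 >= 0
    gives the bound. *)
Lemma invmx_form_le A (c : R) : posdefmx A -> 0 < c ->
  (forall v, c * dotp v v <= bform A v v) ->
  forall v, c * bform (invmx A) v v <= dotp v v.
Proof.
move=> Ad c0 Ac v; have Au := posdefmx_unit Ad; have [As _] := Ad.
set w := v *m invmx A.
have wv : bform (invmx A) v v = dotp w v by rewrite bform_dotp.
have := Ac w; rewrite [bform A w w]bform_dotp mulmxKV//.
have -> : dotp v w = dotp w v by apply: eq_bigr => i _; rewrite mulrC.
have := dotp_ge0 (v - c *: w).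
have -> : dotp (v - c *: w) (v - c *: w) =
    dotp v v - 2 * c * dotp w v + c * (c * dotp w w).
  rewrite /dotp !mulr_sumr -sumrB -big_split/=; apply: eq_bigr => i _.
  by rewrite !mxE; ring.
rewrite wv => h1 h2; have := ler_wpM2l (ltW c0) h2; lra.
Qed.

Lemma posdefmx_inv A : posdefmx A -> posdefmx (invmx A).
Proof.
move=> Ad; have [As Ap] := Ad; have Au := posdefmx_unit Ad.
split=> [|v v0]; first exact: invmx_sym.
have : v *m invmx A != 0.
  by apply: contra_neq v0 => /(congr1 (mulmx^~ A)); rewrite mulmxKV// mul0mx.
by move=> /Ap; rewrite mulmxKV// trmx_mul invmx_sym// mulmxA.
Qed.

End quadratic_forms.

(** * Limits of finite sums and gradients of matrix-valued maps *)

Lemma cvg_sumr (R : realType) (T I : Type) (F : set_system T) {FF : Filter F}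
    (r : seq I) (f : I -> T -> R) (l : I -> R) :
  (forall i, f i @ F --> l i) ->
  (fun x => \sum_(i <- r) f i x) @ F --> \sum_(i <- r) l i.
Proof. by move=> H; apply: (@cvg_big R I +%R 0 xpredT add_continuous T F r f l). Qed.

Lemma continuous_sumr (R : realType) (T : topologicalType) (I : Type) (x : T)
    (r : seq I) (f : I -> T -> R) : (forall i, {for x, continuous (f i)}) ->
  {for x, continuous (fun x => \sum_(i <- r) f i x)}.
Proof. by move=> H; exact: cvg_sumr. Qed.

Definition has_mxgrad (R : realType) (n p q : nat) (M : 'rV[R]_n -> 'M[R]_(p, q))
    (dM : 'I_n -> 'rV[R]_n -> 'M[R]_(p, q)) : Prop :=
  forall k l, has_grad (fun x => M x k l) (fun s x => dM s x k l).

Section matrix_gradients.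
Variables (R : realType) (n : nat).

Lemma has_mxgrad_tr p q (M : 'rV[R]_n -> 'M[R]_(p, q)) dM :
  has_mxgrad M dM -> has_mxgrad (fun x => (M x)^T) (fun s x => (dM s x)^T).
Proof.
move=> H k l; apply: (has_grad_eq (H l k)) => [x|s x]; by rewrite mxE.
Qed.

Lemma has_mxgradD p q (M N : 'rV[R]_n -> 'M[R]_(p, q)) dM dN :
  has_mxgrad M dM -> has_mxgrad N dN ->
  has_mxgrad (fun x => M x + N x) (fun s x => dM s x + dN s x).
Proof.
move=> H H' k l; apply: (has_grad_eq (has_gradD (H k l) (H' k l))) => [x|s x];
  by rewrite mxE.
Qed.

Lemma has_mxgradM p q r (M : 'rV[R]_n -> 'M[R]_(p, q))
    (N : 'rV[R]_n -> 'M[R]_(q, r)) dM dN :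
  has_mxgrad M dM -> has_mxgrad N dN ->
  has_mxgrad (fun x => M x *m N x)
    (fun s x => dM s x *m N x + M x *m dN s x).
Proof.
move=> H H' k l.
apply: (has_grad_eq (has_grad_sum (index_enum 'I_q)
  (fun j => has_gradM (H k j) (H' j l)))) => [x|s x]; first by rewrite mxE.
by rewrite big_split/= [RHS]mxE; congr (_ + _); rewrite mxE.
Qed.

(* The bound K turns G y - G x = - G y (g y - g x) G x into continuity of G. *)
Lemma has_mxgrad_invmx (g : 'rV[R]_n -> 'M[R]_n) dg (K : R) :
  has_mxgrad g dg -> (forall x, g x \in unitmx) ->
  (forall x k l, `|invmx (g x) k l| <= K) ->
  has_mxgrad (fun x => invmx (g x))
    (fun s x => - (invmx (g x) *m dg s x *m invmx (g x))).
Proof.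
move=> Hg gu GK; set G := fun x => invmx (g x).
have GB x y k l : G y k l - G x k l =
    \sum_a (\sum_b (- G y k b) * (g y b a - g x b a)) * G x a l.
  have -> : G y k l - G x k l = (- G y *m (g y - g x) *m G x) k l.
    rewrite mulNmx mulmxBr mulNmx mulVmx// mulmxBl mul1mx -mulmxA mulmxV//.
    by rewrite mulmx1 opprB !mxE.
  rewrite [LHS]mxE; apply: eq_bigr => a _; congr (_ * _); rewrite [LHS]mxE.
  by apply: eq_bigr => b _; rewrite !mxE.
have cg k l : continuous (fun x => g x k l) by case: (Hg k l).
have cG k l : continuous (fun x => G x k l).
  move=> x; apply/continuousP_norm => e e0.
  (* A continuous majorant of |G y k l - G x k l| that vanishes at y = x; bounding G y by K removes
     the only factor not yet known to be continuous. *)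
  pose psi y := \sum_a (\sum_b K * `|g y b a - g x b a|) * `|G x a l|.
  have /continuousP_norm/(_ e e0)[d d0 H] : {for x, continuous psi}.
    apply: continuous_sumr => a; apply: continuousM; last exact: cst_continuous.
    apply: continuous_sumr => b; apply: continuousM; first exact: cst_continuous.
    exact: (cvg_norm (cvgB (cg b a x) (cvg_cst _))).
  exists d => // y /H.
  have -> : psi x = 0.
    rewrite /psi big1// => a _; rewrite big1 ?mul0r// => b _.
    by rewrite subrr normr0 mulr0.
  rewrite subr0; apply: le_trans; rewrite GB.
  apply: le_trans (ler_norm_sum _ _ _) (le_trans _ (ler_norm _)).
  apply: ler_sum => a _; rewrite normrM ler_wpM2r//.
  apply: le_trans (ler_norm_sum _ _ _) _.
  by apply: ler_sum => b _; rewrite normrM normrN ler_wpM2r//; exact: GK.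
have dGE s x k l : (- (G x *m dg s x *m G x)) k l =
    \sum_a (\sum_b (- G x k b) * dg s x b a) * G x a l.
  rewrite -!mulNmx [LHS]mxE; apply: eq_bigr => a _; congr (_ * _).
  by rewrite [LHS]mxE; apply: eq_bigr => b _; rewrite !mxE.
move=> k l; split=> [//|s]; split=> [|x].
  have -> : (fun x => (- (G x *m dg s x *m G x)) k l) =
      (fun x => \sum_a (\sum_b (- G x k b) * dg s x b a) * G x a l).
    by apply/funext => x; rewrite dGE.
  move=> x; apply: continuous_sumr => a; apply: continuousM; last exact: cG.
  apply: continuous_sumr => b; apply: continuousM; first exact: (cvgN (cG k b x)).
  by have [_ /(_ s)[+ _]] := Hg b a; apply.
set v : 'rV[R]_n := delta_mx 0 s.
(* The identity [GB] divided by h: the left factor sits at the moving point h v + x and converges by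
   [cG], the middle one is the difference quotient of g. *)
have c : (fun h : R => h^-1 *:
      (((fun x => G x k l) \o shift x) (h *: v) - G x k l)) @ 0^' -->
    (- (G x *m dg s x *m G x)) k l.
  rewrite dGE.
  have -> : (fun h : R => h^-1 *:
      (((fun x => G x k l) \o shift x) (h *: v) - G x k l)) =
     (fun h : R => \sum_a (\sum_b (- G (h *: v + x) k b) *
         (h^-1 *: (((fun x => g x b a) \o shift x) (h *: v) - g x b a))) * G x a l).
    apply/funext => h /=; rewrite GB scaler_sumr; apply: eq_bigr => a _.
    rewrite scalerAl scaler_sumr; congr (_ * _); apply: eq_bigr => b _.
    by rewrite scalerAr.
  apply: cvg_sumr => a; apply: cvgM; last exact: cvg_cst.
  apply: cvg_sumr => b; apply: cvgM.
    have cl : {for 0, continuous (fun h : R => h *: v + x)}.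
      exact: (cvgD (@scalel_continuous _ _ v 0) (cvg_cst _)).
    have := @continuous_comp _ _ _ _ (fun y => - G y k b) _ cl.
    rewrite scale0r add0r => /(_ (cvgN (cG k b x))).
    by move=> /continuous_withinNx; rewrite /= scale0r add0r.
  have [_ /(_ s)[_ /(_ x)[H E]]] := Hg b a.
  by rewrite -E; exact: H.
by split; [apply/cvg_ex; eexists; exact: c|exact: cvg_lim].
Qed.

End matrix_gradients.

(** * The Liouville property of elliptic operators with drift -x.D *)

(** The norm on row vectors is the maximum norm, attained at one coordinate; this links its balls to
    the Euclidean quantities below. *)
Lemma sqr_norm_le_dotp (R : realType) (n : nat) (x : 'rV[R]_n) :
  `|x| ^+ 2 <= dotp x x.
Proof.
have [->|x0] := eqVneq `|x| 0; first by rewrite expr0n dotp_ge0.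
have [[i j] E] := mx_norm_neq0 (x0 : mx_norm x != 0).
have {E} -> : `|x| = `|x i j| by [].
by rewrite real_normK ?num_real// ord1 le_sqr_dotp.
Qed.

Section maximum_principle.
Variables (R : realType) (n : nat).
Implicit Types (x y z : 'rV[R]_n) (G : 'M[R]_n).

(** The operator L at a single point, applied to the values of a gradient and a Hessian rather than
    to a function, so that its linearity is pure algebra. *)
Definition drift_op G x (p : 'I_n -> R) (H : 'I_n -> 'I_n -> R) : R :=
  \sum_i \sum_j G i j * H i j - \sum_i x 0 i * p i.

Lemma drift_opD G x p q H K :
  drift_op G x (fun i => p i + q i) (fun i j => H i j + K i j) =
  drift_op G x p H + drift_op G x q K.
Proof.
rewrite /drift_op addrACA -opprD -!big_split/=; congr (_ - _).
  by apply: eq_bigr => i _; rewrite -big_split/=; apply: eq_bigr => j _; rewrite mulrDr.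
by apply: eq_bigr => i _; rewrite mulrDr.
Qed.

Lemma drift_opZ G x a p H :
  drift_op G x (fun i => a * p i) (fun i j => a * H i j) = a * drift_op G x p H.
Proof.
rewrite /drift_op mulrBr !mulr_sumr; congr (_ - _).
  by apply: eq_bigr => i _; rewrite mulr_sumr; apply: eq_bigr => j _; rewrite mulrCA.
by apply: eq_bigr => i _; rewrite mulrCA.
Qed.

(** At a maximum the drift term vanishes, and minus the second-order part is the trace of [G] times
    a matrix with non-negative form. *)
Lemma drift_op_max f df ddf G x : has_grad f df ->
  (forall i, has_grad (df i) (ddf i)) -> (forall z, f z <= f x) -> psdmx G ->
  drift_op G x (df^~ x) (fun i j => ddf i j x) <= 0.
Proof.
move=> H H2 fmax Gp; have [df0 hess] := has_grad_max H H2 fmax.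
rewrite /drift_op [X in _ - X]big1 ?subr0 => [|i _]; last by rewrite df0 mulr0.
rewrite -oppr_ge0.
pose C : 'M[R]_n := \matrix_(j, i) (- ddf i j x).
have -> : - (\sum_i \sum_j G i j * ddf i j x) = \tr (G *m C).
  rewrite /mxtrace -sumrN; apply: eq_bigr => i _; rewrite mxE -sumrN.
  by apply: eq_bigr => j _; rewrite mxE mulrN.
apply: mxtrace_psdM => // v.
rewrite -oppr_le0; apply: le_trans (hess v); rewrite le_eqVlt; apply/orP; left.
apply/eqP; rewrite bform_dotp /dotp -sumrN; apply: eq_bigr => i _.
rewrite mxE mulr_suml -sumrN; apply: eq_bigr => j _.
by rewrite mxE; ring.
Qed.

Definition sqdist y x : R := dotp (x - y) (x - y).

Lemma has_grad_sqdist y :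
  has_grad (sqdist y) (fun i x => 2 * (x 0 i - y 0 i)).
Proof.
have H k := has_gradD (has_grad_coord R k) (has_grad_cst n (- y 0 k)).
apply: (has_grad_eq (has_grad_sum (index_enum 'I_n)
  (fun k => has_gradM (H k) (H k)))) => [x|i x].
  by apply: eq_bigr => k _; rewrite !mxE.
rewrite (bigD1 i)//= big1 => [|k ki]; first by rewrite eqxx/=; ring.
by rewrite eq_sym (negbTE ki)/=; ring.
Qed.

Lemma has_grad_sqdist2 y i :
  has_grad (fun x => 2 * (x 0 i - y 0 i)) (fun j _ => 2 * (j == i)%:R).
Proof.
have H := has_gradZ 2 (has_gradD (has_grad_coord R i) (has_grad_cst n (- y 0 i))).
by apply: (has_grad_eq H) => // j x; rewrite addr0.
Qed.

Lemma drift_op_sqdist G y x :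
  drift_op G x (fun i => 2 * (x 0 i - y 0 i)) (fun i j => 2 * (j == i)%:R) =
  2 * (\tr G - dotp x (x - y)).
Proof.
rewrite drift_opZ /drift_op; congr (_ * (_ - _)).
  apply: eq_bigr => i _; rewrite (bigD1 i)//= eqxx mulr1 big1 ?addr0//.
  by move=> j /negbTE ->; rewrite mulr0.
by apply: eq_bigr => i _; rewrite !mxE.
Qed.

(** Hopf's barrier: its Hessian has a term of order lam^2 along x - y, against order lam elsewhere,
    so a large lam makes it a strict subsolution away from y. *)
Definition bump lam y x : R := expR (- lam * sqdist y x).
Definition bump1 lam y (i : 'I_n) x : R :=
  - lam * (2 * (x 0 i - y 0 i)) * bump lam y x.
Definition bump2 lam y (i j : 'I_n) x : R :=
  - lam * (2 * (j == i)%:R) * bump lam y x +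
  - lam * (2 * (x 0 i - y 0 i)) * bump1 lam y j x.

Lemma has_grad_bump lam y : has_grad (bump lam y) (bump1 lam y).
Proof. exact: (has_grad_expR (has_gradZ (- lam) (has_grad_sqdist y))). Qed.

Lemma has_grad_bump1 lam y i : has_grad (bump1 lam y i) (bump2 lam y i).
Proof.
exact: (has_gradM (has_gradZ (- lam) (has_grad_sqdist2 y i)) (has_grad_bump lam y)).
Qed.

Lemma drift_op_bump lam G y x :
  drift_op G x ((bump1 lam y)^~ x) (fun i j => bump2 lam y i j x) =
  bump lam y x * (2 * lam) *
    (2 * lam * bform G (x - y) (x - y) + dotp x (x - y) - \tr G).
Proof.
set h := bump lam y x.
(* The Hessian is a multiple of the identity, treated as for [sqdist], plus a rank-one part that
   contracts to the form of [G] at x - y. *)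
transitivity (drift_op G x
  (fun i => (- lam * h) * (2 * (x 0 i - y 0 i)) + (4 * lam ^+ 2 * h) * 0)
  (fun i j => (- lam * h) * (2 * (j == i)%:R) +
     (4 * lam ^+ 2 * h) * ((x - y) 0 i * (x - y) 0 j))).
  rewrite /drift_op; congr (_ - _); apply: eq_bigr => i _.
    apply: eq_bigr => j _; congr (_ * _).
    by rewrite /bump2 /bump1 -/h !mxE; ring.
  by congr (_ * _); rewrite /bump1 -/h; ring.
rewrite drift_opD (drift_opZ _ _ (- lam * h)) (drift_opZ _ _ (4 * lam ^+ 2 * h)).
rewrite drift_op_sqdist.
have -> : drift_op G x (fun=> 0) (fun i j => (x - y) 0 i * (x - y) 0 j) =
    bform G (x - y) (x - y).
  rewrite /drift_op [X in _ - X]big1 ?subr0 => [|i _]; last by rewrite mulr0.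
  rewrite bform_dotp /dotp exchange_big/=; apply: eq_bigr => j _.
  rewrite [X in _ = X * _]mxE mulr_suml; apply: eq_bigr => i _.
  by rewrite mulrA [G i j * _]mulrC.
ring.
Qed.

(* If f y < f x0, then f + del * bump - eta * |x|^2 has a maximum, which lies
   outside a ball around y.  There the bump is a strict subsolution, since lam
   is large, and it beats the contribution of eta * |x|^2, since the maximum
   point satisfies |x|^2 <= T and hence bump >= kap. *)
Lemma drift_subsolution_le (f : 'rV[R]_n -> R) df ddf (G : 'rV[R]_n -> 'M[R]_n)
    (C T : R) :
  has_grad f df -> (forall i, has_grad (df i) (ddf i)) -> (forall x, f x <= C) ->
  0 <= T -> (forall x, psdmx (G x)) -> (forall x, \tr (G x) <= T) ->
  (forall x v, dotp v v <= bform (G x) v v) ->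
  (forall x, 0 <= drift_op (G x) x (df^~ x) (fun i j => ddf i j x)) ->
  forall x y, f x <= f y.
Proof.
move=> Hf Hf2 fC T0 Gp GT G1 Lf x0 y; rewrite leNgt; apply/negP => fyx.
have cf : continuous f by case: Hf.
(* A quarter of the gap: near y the perturbed function stays below f y + 2 del, while at x0 it
   exceeds f y + 3 del. *)
pose del := (f x0 - f y) / 4.
have del0 : 0 < del by rewrite divr_gt0 ?subr_gt0.
have [r r0 Hr] := (continuousP_norm f y).1 (cf y) del del0.
(* Outside the ball lam r^2 outweighs tr G <= T and the worst case -|y|^2/4 of x.(x - y), leaving at
   least 1. *)
pose lam := (T + dotp y y / 4 + 1) / r ^+ 2.
have yy0 := dotp_ge0 y.
have lam0 : 0 < lam by rewrite divr_gt0 ?exprn_gt0//; lra.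
(* Lower bound for the bump where |x|^2 <= T, from |x - y|^2 <= 2 |x|^2 + 2 |y|^2. *)
pose kap := expR (- lam * (2 * T + 2 * dotp y y)).
have kap0 : 0 < kap := expR_gt0 _.
(* The first bound keeps the penalty at x0 below [del], the second makes [eta2] contradict the final
   inequality; each + 1 gives a positive denominator and strictness. *)
pose eta := Num.min (del / (sqdist 0 x0 + 1)) (del * lam * kap / (T + 1)).
have T1 : 0 < T + 1 by lra.
have x01 : 0 < sqdist 0 x0 + 1 by rewrite ltr_wpDl// dotp_ge0.
have eta0 : 0 < eta.
  by rewrite lt_min (divr_gt0 del0 x01) divr_gt0 ?(mulr_gt0 (mulr_gt0 del0 lam0)).
have eta1 : eta * sqdist 0 x0 < del.
  apply: (@lt_le_trans _ _ (eta * (sqdist 0 x0 + 1))).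
    by rewrite ltr_pM2l// ltrDl.
  by rewrite -ler_pdivlMr// /eta ge_min lexx.
have eta2 : eta * T < del * lam * kap.
  apply: (@lt_le_trans _ _ (eta * (T + 1))); first by rewrite ltr_pM2l// ltrDl.
  by rewrite -ler_pdivlMr// /eta ge_min lexx orbT.
pose F x := f x + (del * bump lam y x + - eta * sqdist 0 x).
pose dF i x := df i x + (del * bump1 lam y i x +
  - eta * (2 * (x 0 i - (0 : 'rV[R]_n) 0 i))).
pose ddF i j x := ddf i j x + (del * bump2 lam y i j x + - eta * (2 * (j == i)%:R)).
have HF : has_grad F dF.
  exact: (has_gradD Hf (has_gradD (has_gradZ del (has_grad_bump lam y))
    (has_gradZ (- eta) (has_grad_sqdist 0)))).
have HF2 i : has_grad (dF i) (ddF i).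
  exact: (has_gradD (Hf2 i) (has_gradD (has_gradZ del (has_grad_bump1 lam y i))
    (has_gradZ (- eta) (has_grad_sqdist2 0 i)))).
have cF : continuous F by case: HF.
have bump01 x : 0 < bump lam y x <= 1.
  rewrite expR_gt0/= -expR0 ler_expR mulNr oppr_le0 mulr_ge0 ?dotp_ge0//.
  exact: ltW.
have Fx0 : f y + 3 * del < F x0.
  have /andP[b0 _] := bump01 x0; have : 0 < del * bump lam y x0 by rewrite mulr_gt0.
  have : f x0 = f y + 4 * del by rewrite /del; field.
  rewrite /F; lra.
have Fball x : `|x - y| < r -> F x < F x0.
  move=> /Hr; rewrite ler_norml => /andP[_ fxy]; apply: lt_trans Fx0.
  have /andP[_ b1] := bump01 x.
  have : del * bump lam y x <= del by rewrite ler_piMr// ltW.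
  have : 0 <= eta * sqdist 0 x by rewrite mulr_ge0 ?dotp_ge0// ltW.
  rewrite /F; lra.
(* Beyond [rho] the penalty eta |x|^2 exceeds C + del - F x0, so a maximum over this closed ball is
   global. *)
pose rho := Num.sqrt (`|C + del - F x0| / eta) + 1.
have rho0 : 0 < rho by rewrite ltr_wpDl// sqrtr_ge0.
have Ffar x : rho < `|x| -> F x < F x0.
  move=> xr.
  have h1 : rho ^+ 2 <= sqdist 0 x.
    rewrite /sqdist subr0; apply: le_trans (sqr_norm_le_dotp x).
    rewrite ler_pXn2r ?nnegrE//; exact: ltW.
  have h2 : `|C + del - F x0| / eta < rho ^+ 2.
    have q0 : 0 <= `|C + del - F x0| / eta by rewrite divr_ge0// ltW.
    have := sqrtr_ge0 (`|C + del - F x0| / eta).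
    rewrite -{2}(sqr_sqrtr q0) /rho; set s := Num.sqrt _; nra.
  have h3 : C + del - F x0 < eta * sqdist 0 x.
    apply: le_lt_trans (ler_norm _) _; rewrite -ltr_pdivrMl// mulrC.
    exact: lt_le_trans h1.
  have /andP[_ b1] := bump01 x.
  have : del * bump lam y x <= del by rewrite ler_piMr// ltW.
  have -> : F x = f x + (del * bump lam y x + - eta * sqdist 0 x) by [].
  have := fC x; lra.
pose B := [set x : 'rV[R]_n | `|x| <= rho].
have x0B : B x0.
  by rewrite /B/= leNgt; apply/negP => /Ffar; rewrite ltxx.
have cB : compact B.
  apply: bounded_closed_compact.
    by exists rho; split=> [|M rM v /le_trans]; [exact: num_real|apply; exact: ltW].
  apply: (@closed_comp _ _ (fun x : 'rV[R]_n => `|x|) [set t | t <= rho]).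
    by move=> x _; exact: norm_continuous.
  exact: closed_le.
have [x1 x1B x1max] := EVT_max_rV (ex_intro _ x0 x0B) cB (continuous_subspaceT cF).
have F01 : F x0 <= F x1 by apply: x1max; rewrite inE.
have Fmax z : F z <= F x1.
  have [zB|/Ffar/ltW zB] := leP `|z| rho; first by apply: x1max; rewrite inE.
  exact: le_trans F01.
have x1r : r <= `|x1 - y|.
  by rewrite leNgt; apply/negP => /Fball; rewrite ltNge F01.
have := drift_op_max HF HF2 Fmax (Gp x1).
rewrite !drift_opD (drift_opZ _ _ del) (drift_opZ _ _ (- eta)).
rewrite drift_op_bump drift_op_sqdist subr0.
have {x1r} zz : r ^+ 2 <= dotp (x1 - y) (x1 - y).
  by apply: le_trans (sqr_norm_le_dotp _); rewrite ler_pXn2r ?nnegrE// ltW.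
set z := x1 - y in zz *.
(* Complete the square: x.(x - y) = |x - y/2|^2 - |y|^2/4. *)
have xz : - (dotp y y / 4) <= dotp x1 z.
  have := dotp_ge0 (z + 2^-1 *: y).
  have -> : dotp (z + 2^-1 *: y) (z + 2^-1 *: y) = dotp x1 z + dotp y y / 4.
    rewrite /dotp mulr_suml -big_split/=; apply: eq_bigr => i _.
    by rewrite !mxE; field.
  lra.
have /andP[b0 _] := bump01 x1.
have br : 1 <= 2 * lam * bform (G x1) z z + dotp x1 z - \tr (G x1).
  have e1 : lam * r ^+ 2 = T + dotp y y / 4 + 1.
    by rewrite /lam divfK// gt_eqF// exprn_gt0.
  have e2 : lam * r ^+ 2 <= lam * bform (G x1) z z.
    by rewrite ler_pM2l//; apply: le_trans zz (G1 _ _).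
  have := GT x1; lra.
have Lb : del * (2 * lam * bump lam y x1) <= del * (bump lam y x1 * (2 * lam) *
    (2 * lam * bform (G x1) z z + dotp x1 z - \tr (G x1))).
  rewrite ler_pM2l// (mulrC (2 * lam)) ler_peMr// mulr_ge0 ?(ltW b0)//.
  by rewrite mulr_ge0 ?(ltW lam0).
have e3 : eta * \tr (G x1) <= eta * T by rewrite ler_pM2l.
have lb0 : 0 < del * (lam * bump lam y x1) by rewrite mulr_gt0 ?(mulr_gt0 lam0 b0).
have := Lf x1 => L0 L1.
(* Used twice: dropping the bump term gives |x1|^2 <= T and hence bump >= kap; dropping the first
   term then contradicts [eta2]. *)
have key : eta * dotp x1 x1 + del * (lam * bump lam y x1) <= eta * T by lra.
have x1T : dotp x1 x1 <= T.
  by rewrite -(ler_pM2l eta0); lra.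
have kb : kap <= bump lam y x1.
  rewrite ler_expR !mulNr lerN2 ler_pM2l// /sqdist -/z.
  have := dotp_ge0 (x1 + y).
  have -> : dotp (x1 + y) (x1 + y) = 2 * dotp x1 x1 + 2 * dotp y y - dotp z z.
    rewrite /dotp !mulr_sumr -big_split -sumrB/=; apply: eq_bigr => i _.
    by rewrite !mxE; ring.
  lra.
have k2 : del * lam * kap <= del * (lam * bump lam y x1).
  by rewrite -mulrA ler_pM2l// ler_pM2l.
have : 0 <= eta * dotp x1 x1 by rewrite mulr_ge0 ?dotp_ge0// ltW.
lra.
Qed.

End maximum_principle.

(** * The drift Laplacian of the inverse metric *)

Section contraction.
Variables (R : comNzRingType) (n : nat) (G : 'M[R]_n).
Hypothesis Gsym : G^T = G.

(** Contraction of the two derivative indices with g^{st}, kept matrix-valued so that the remaining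
    indices are handled by matrix products. *)
Definition mxcontract p q (X : 'I_n -> 'I_n -> 'M[R]_(p, q)) : 'M[R]_(p, q) :=
  \sum_s \sum_t G s t *: X s t.

Lemma eq_mxcontract p q (X Y : 'I_n -> 'I_n -> 'M[R]_(p, q)) :
  (forall s t, X s t = Y s t) -> mxcontract X = mxcontract Y.
Proof. by move=> E; apply: eq_bigr => s _; apply: eq_bigr => t _; rewrite E. Qed.

Lemma mxcontractD p q (X Y : 'I_n -> 'I_n -> 'M[R]_(p, q)) :
  mxcontract (fun s t => X s t + Y s t) = mxcontract X + mxcontract Y.
Proof.
rewrite /mxcontract -big_split/=; apply: eq_bigr => s _.
by rewrite -big_split/=; apply: eq_bigr => t _; rewrite scalerDr.
Qed.

Lemma mxcontract_swap p q (X : 'I_n -> 'I_n -> 'M[R]_(p, q)) :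
  mxcontract (fun s t => X t s) = mxcontract X.
Proof.
rewrite /mxcontract exchange_big/=; apply: eq_bigr => s _; apply: eq_bigr => t _.
by rewrite -{1}Gsym mxE.
Qed.

Lemma mxcontract_tr p q (X : 'I_n -> 'I_n -> 'M[R]_(p, q)) :
  mxcontract (fun s t => (X s t)^T) = (mxcontract X)^T.
Proof.
rewrite /mxcontract linear_sum/=; apply: eq_bigr => s _.
by rewrite linear_sum/=; apply: eq_bigr => t _; rewrite linearZ.
Qed.

Lemma mxcontract_mulr p q r (X : 'I_n -> 'I_n -> 'M[R]_(p, q)) (B : 'M[R]_(q, r)) :
  mxcontract (fun s t => X s t *m B) = mxcontract X *m B.
Proof.
rewrite /mxcontract mulmx_suml; apply: eq_bigr => s _.
by rewrite mulmx_suml; apply: eq_bigr => t _; rewrite scalemxAl.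
Qed.

Lemma mxcontract_mull p q r (X : 'I_n -> 'I_n -> 'M[R]_(p, q)) (B : 'M[R]_(r, p)) :
  mxcontract (fun s t => B *m X s t) = B *m mxcontract X.
Proof.
rewrite /mxcontract mulmx_sumr; apply: eq_bigr => s _.
by rewrite mulmx_sumr; apply: eq_bigr => t _; rewrite scalemxAr.
Qed.

(** Stacking the rows r X_s into [Z] turns the double sum into a trace whose sign is visible when
    [G] and [K] are positive semidefinite. *)
Lemma bform_mxcontract q (K : 'M[R]_q) (X : 'I_n -> 'M[R]_(n, q)) (r : 'rV[R]_n) :
  let Z := \matrix_(s < n) (r *m X s) in
  bform (mxcontract (fun s t => X s *m K *m (X t)^T)) r r =
  \tr (G *m (Z *m K *m Z^T)).
Proof.
move=> Z.
have -> : bform (mxcontract (fun s t => X s *m K *m (X t)^T)) r r =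
    mxcontract (fun s t => r *m X s *m K *m (r *m X t)^T) 0 0.
  rewrite /bform -mxcontract_mull -mxcontract_mulr; congr (_ _ 0 0).
  by apply: eq_mxcontract => s t; rewrite trmx_mul !mulmxA.
rewrite -mxcontract_swap /mxcontract summxE; apply: eq_bigr => s _.
rewrite summxE [RHS]mxE; apply: eq_bigr => t _; rewrite [LHS]mxE; congr (_ * _).
rewrite [LHS]mxE [RHS]mxE; apply: eq_bigr => k _.
have ZE i j : Z i j = (r *m X i) 0 j by rewrite mxE.
rewrite ![_^T _ _]mxE ZE; congr (_ * _); rewrite [LHS]mxE [RHS]mxE.
by apply: eq_bigr => j _; rewrite ZE.
Qed.

Variables (m : nat) (P : 'M[R]_(n, m)) (U : 'I_n -> 'M[R]_(n, m)).
Variables (U2 : 'I_n -> 'I_n -> 'M[R]_(n, m)) (x : 'rV[R]_n).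
Hypothesis Usym : forall s k a, U s k a = U k s a.
Let M s : 'M[R]_n := U s *m P^T.
(** In the application this is minus the derivative of the metric 1 - P P^T in direction s. *)
Let S s : 'M[R]_n := M s + (M s)^T.
(* The shrinker system differentiated in direction k. *)
Hypothesis U2E : forall k a,
  (mxcontract U2 - \sum_s x 0 s *: U s) k a =
  - \sum_s \sum_t (G *m S k *m G) s t * U s t a.

Lemma slice_sym s k l : M s k l = M k s l.
Proof. by rewrite !mxE; apply: eq_bigr => a _; rewrite Usym. Qed.

(** Multiplying the differentiated system by P^T turns its right side into products of slices; the
    two halves of [S k] contribute equally, whence the factor 2. *)
Lemma mxcontract_U2P :
  (mxcontract U2 - \sum_s x 0 s *: U s) *m P^T =
  - (mxcontract (fun s t => M s *m G *m M t) *+ 2).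
Proof.
apply/matrixP => k l; rewrite mxE.
under eq_bigr => a _ do rewrite U2E mulNr mulr_suml.
rewrite sumrN [RHS]mxE mulmxnE; congr (- _).
have E (N : 'M[R]_n) : \sum_a (\sum_s (\sum_t N s t * U s t a) * P^T a l) =
    \sum_s \sum_t N s t * M s t l.
  rewrite exchange_big/=; apply: eq_bigr => s _.
  under eq_bigr => a _ do rewrite mulr_suml.
  rewrite exchange_big/=; apply: eq_bigr => t _.
  by rewrite mxE mulr_sumr; apply: eq_bigr => a _; rewrite mulrA.
rewrite E /S mulmxDr mulmxDl.
have -> : G *m (M k)^T *m G = (G *m M k *m G)^T.
  by rewrite !trmx_mul Gsym mulmxA.
set N := G *m M k *m G.
have -> : \sum_s \sum_t (N + N^T) s t * M s t l =
    (\sum_s \sum_t N s t * M s t l) *+ 2.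
  (* Transposing [N] exchanges s and t, under which (M_s)_{tl} is invariant. *)
  have E2 : \sum_s \sum_t N^T s t * M s t l = \sum_s \sum_t N s t * M s t l.
    rewrite exchange_big/=; apply: eq_bigr => s _; apply: eq_bigr => t _.
    by rewrite mxE slice_sym.
  rewrite mulr2n; transitivity (\sum_s \sum_t N s t * M s t l +
    \sum_s \sum_t N^T s t * M s t l); last by rewrite E2.
  rewrite -big_split/=; apply: eq_bigr => s _.
  by rewrite -big_split/=; apply: eq_bigr => t _; rewrite mxE mulrDl.
congr (_ *+ 2); rewrite -mxcontract_swap /mxcontract summxE; apply: eq_bigr => s _.
transitivity ((N *m M s) s l); first by rewrite [RHS]mxE.
have -> : N *m M s = G *m (M k *m (G *m M s)) by rewrite /N !mulmxA.
rewrite summxE [LHS]mxE; apply: eq_bigr => a _.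
have -> : M a *m G *m M s = M a *m (G *m M s) by rewrite mulmxA.
rewrite [RHS]mxE; congr (_ * _); rewrite [LHS]mxE [RHS]mxE.
by apply: eq_bigr => b _; rewrite slice_sym.
Qed.

(** The left side is L G without its outer factors G. With A the contraction of M_s G M_t, the third
    derivatives contribute -2 (A + A^T), and the two S G S terms contribute 2 (A + A^T) plus twice
    the first two contractions on the right. *)
Lemma drift_metric_identity :
  mxcontract (fun s t => S t *m G *m S s +
    (U2 s t *m P^T + U s *m (U t)^T + (U2 s t *m P^T + U s *m (U t)^T)^T) +
    S s *m G *m S t) - \sum_s x 0 s *: S s =
  (mxcontract (fun s t => M s *m G *m (M t)^T) +
   mxcontract (fun s t => (M s)^T *m G *m ((M t)^T)^T) +
   mxcontract (fun s t => U s *m 1%:M *m (U t)^T)) *+ 2.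
Proof.
rewrite !mxcontractD mxcontract_tr mxcontractD.
rewrite (mxcontract_swap (fun s t => S s *m G *m S t)) mxcontract_mulr.
have -> : \sum_s x 0 s *: S s =
    (\sum_s x 0 s *: U s) *m P^T + ((\sum_s x 0 s *: U s) *m P^T)^T.
  rewrite mulmx_suml linear_sum/= -big_split/=; apply: eq_bigr => s _.
  by rewrite -scalemxAl linearZ/= -scalerDr.
have -> : mxcontract (fun s t => U s *m 1%:M *m (U t)^T) =
    mxcontract (fun s t => U s *m (U t)^T).
  by apply: eq_mxcontract => s t; rewrite mulmx1.
have UUT : (mxcontract (fun s t => U s *m (U t)^T))^T =
    mxcontract (fun s t => U s *m (U t)^T).
  rewrite -mxcontract_tr -[RHS]mxcontract_swap; apply: eq_mxcontract => s t.
  by rewrite trmx_mul trmxK.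
have SGS : mxcontract (fun s t => S s *m G *m S t) =
    mxcontract (fun s t => M s *m G *m M t) +
    mxcontract (fun s t => M s *m G *m (M t)^T) +
    (mxcontract (fun s t => (M s)^T *m G *m ((M t)^T)^T) +
     (mxcontract (fun s t => M s *m G *m M t))^T).
  have -> : (mxcontract (fun s t => M s *m G *m M t))^T =
      mxcontract (fun s t => (M s)^T *m G *m (M t)^T).
    rewrite -mxcontract_tr -[RHS]mxcontract_swap; apply: eq_mxcontract => s t.
    by rewrite !trmx_mul Gsym mulmxA.
  rewrite -!mxcontractD; apply: eq_mxcontract => s t.
  by rewrite /S trmxK mulmxDl mulmxDl !mulmxDr.
rewrite SGS linearD/= UUT.
set A := mxcontract (fun s t => M s *m G *m M t).
set C1 := mxcontract (fun s t => M s *m G *m (M t)^T).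
set C2 := mxcontract (fun s t => (M s)^T *m G *m _).
set C3 := mxcontract (fun s t => U s *m _).
set Y := \sum_s x 0 s *: U s.
have EA : mxcontract U2 *m P^T = Y *m P^T - (A *+ 2).
  by have := mxcontract_U2P; rewrite mulmxBl => /eqP; rewrite subr_eq addrC => /eqP.
rewrite EA linearB/= linearMn/=.
apply/matrixP => k l; rewrite !(mxE, mulmxnE); ring.
Qed.

End contraction.

(** * The shrinker system: bounds on G, its derivatives, and vanishing of the Hessian of u *)

Section shrinker.
Variables (R : realType) (n m : nat) (u : 'rV[R]_n -> 'rV[R]_m).
Hypothesis n0 : (0 < n)%N.
Hypothesis u_smooth : smooth_map u.
Hypothesis spacelike : forall x, posdefmx (graph_metric u x).
Hypothesis shrinker : forall x a,
  \sum_i \sum_j invmx (graph_metric u x) i j * partial i (partial j (component u a)) x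
  = - component u a x + dotp x (gradient (component u a) x).
Variable c : R.
Hypothesis c0 : 0 < c.
Hypothesis eig : forall x l, eigenvalue (graph_metric u x) l -> c <= l.

Let G x : 'M[R]_n := invmx (graph_metric u x).
Let P x : 'M[R]_(n, m) := \matrix_(k, a) partials [:: k] (component u a) x.
Let U s x : 'M[R]_(n, m) := \matrix_(k, a) partials [:: s; k] (component u a) x.
Let U2 t s x : 'M[R]_(n, m) :=
  \matrix_(k, a) partials [:: t; s; k] (component u a) x.
Let M s x : 'M[R]_n := U s x *m (P x)^T.
Let S s x : 'M[R]_n := M s x + (M s x)^T.

Lemma has_mxgrad_P : has_mxgrad P U.
Proof.
by move=> k a; apply: (has_grad_eq (has_grad_partials [:: k] (u_smooth a))) => [x|s x];
  rewrite mxE.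
Qed.

Lemma has_mxgrad_U s : has_mxgrad (U s) (fun t => U2 t s).
Proof.
by move=> k a; apply: (has_grad_eq (has_grad_partials [:: s; k] (u_smooth a))) => [x|t x];
  rewrite mxE.
Qed.

Lemma partials_swap s i j a :
  partials [:: i, j & s] (component u a) = partials [:: j, i & s] (component u a).
Proof.
apply/funext => x.
exact: (has_grad_sym j i x (has_grad_partials s (u_smooth a))
  (fun k => has_grad_partials (k :: s) (u_smooth a))).
Qed.

Lemma U_sym s k a x : U s x k a = U k x s a.
Proof.
by rewrite [LHS]mxE [RHS]mxE; exact: (congr1 (@^~ x) (partials_swap [::] s k a)).
Qed.

Lemma graph_metricE x : graph_metric u x = 1%:M - P x *m (P x)^T.
Proof.
apply/matrixP => i j; rewrite !mxE; congr (_ - _).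
by apply: eq_bigr => a _; rewrite !mxE.
Qed.

Lemma metric_unit x : graph_metric u x \in unitmx.
Proof. exact: posdefmx_unit. Qed.

(** The fibre directions are negative, so they only subtract the square P P^T; inverted, this is the
    ellipticity G >= 1. *)
Lemma metric_le x v : bform (graph_metric u x) v v <= dotp v v.
Proof.
rewrite graph_metricE bformB bform_scalar mul1r gerBl.
have -> : bform (P x *m (P x)^T) v v = dotp (v *m P x) (v *m P x).
  rewrite /bform mulmxA -mulmxA -trmx_mul mxE.
  by apply: eq_bigr => i _; rewrite [X in _ * X]mxE.
exact: dotp_ge0.
Qed.

Lemma metric_ge x v : c * dotp v v <= bform (graph_metric u x) v v.
Proof. by apply: psdmx_ge_eigenvalues; [|case: (spacelike x)|exact: eig]. Qed.

Lemma G_posdef x : posdefmx (G x). Proof. exact: posdefmx_inv. Qed.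
Lemma G_psd x : psdmx (G x). Proof. exact/posdefmx_psd/G_posdef. Qed.
Lemma G_sym x : (G x)^T = G x. Proof. by case: (G_posdef x). Qed.

Lemma dotp_delta i : dotp (delta_mx 0 i : 'rV[R]_n) (delta_mx 0 i) = 1.
Proof.
rewrite /dotp (bigD1 i)//= big1 ?addr0; first by rewrite !mxE !eqxx mulr1.
by move=> j /negbTE ji; rewrite !mxE ji andbF mul0r.
Qed.

Lemma bform_delta (A : 'M[R]_n) i j :
  bform A (delta_mx 0 i) (delta_mx 0 j) = A i j.
Proof. by rewrite bform_deltar -rowE mxE. Qed.

Lemma G_diag_le x i : G x i i <= c^-1.
Proof.
have := invmx_form_le (spacelike x) c0 (metric_ge x) (delta_mx 0 i).
by rewrite bform_delta dotp_delta mulrC -ler_pdivlMr// div1r.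
Qed.

(** The form at e_k + e_l and e_k - e_l is non-negative, so off-diagonal entries are bounded by the
    mean of two diagonal ones. This is the constant required by [has_mxgrad_invmx]. *)
Lemma G_bounded x k l : `|G x k l| <= c^-1.
Proof.
have [_ Gp] := G_psd x.
have h1 := Gp (delta_mx 0 k + delta_mx 0 l).
have h2 := Gp (delta_mx 0 k + (-1) *: delta_mx 0 l).
have lk : G x l k = G x k l by rewrite -[in LHS]G_sym mxE.
move: h1 h2; rewrite !(bformDl, bformDr, bformZl, bformZr) !bform_delta lk.
have := G_diag_le x k; have := G_diag_le x l.
by rewrite ler_norml => *; apply/andP; split; lra.
Qed.

Lemma tr_G_le x : \tr (G x) <= n%:R / c.
Proof.
rewrite /mxtrace; apply: (le_trans (ler_sum _ (fun i _ => G_diag_le x i))).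
by rewrite sumr_const card_ord mulr_natl.
Qed.

Lemma has_mxgrad_S s : has_mxgrad (S s) (fun t x =>
  (U2 t s x *m (P x)^T + U s x *m (U t x)^T) +
  (U2 t s x *m (P x)^T + U s x *m (U t x)^T)^T).
Proof.
have H : has_mxgrad (M s) (fun t x => U2 t s x *m (P x)^T + U s x *m (U t x)^T).
  exact: (has_mxgradM (has_mxgrad_U s) (has_mxgrad_tr has_mxgrad_P)).
exact: (has_mxgradD H (has_mxgrad_tr H)).
Qed.

Lemma has_mxgrad_metric : has_mxgrad (graph_metric u) (fun s x => - S s x).
Proof.
have H := has_mxgradM has_mxgrad_P (has_mxgrad_tr has_mxgrad_P).
move=> k l; apply: (has_grad_eq (has_gradD (has_grad_cst n ((k == l)%:R : R))
  (has_gradZ (-1) (H k l)))) => [x|s x].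
  by rewrite graph_metricE !mxE mulN1r.
rewrite add0r mulN1r [RHS]mxE; congr (- _).
by rewrite [LHS]mxE [RHS]mxE /M trmx_mul trmxK.
Qed.

Lemma has_mxgrad_G : has_mxgrad G (fun s x => G x *m S s x *m G x).
Proof.
move=> k l.
apply: (has_grad_eq (has_mxgrad_invmx has_mxgrad_metric metric_unit G_bounded k l)).
  by [].
by move=> s x; rewrite mulmxN mulNmx opprK.
Qed.

(** The outer factors G are pulled out so that the bracket is the integrand of
    [drift_metric_identity]. *)
Lemma has_mxgrad_G2 s : has_mxgrad (fun x => G x *m S s x *m G x) (fun t x =>
  G x *m (S t x *m G x *m S s x +
   (U2 t s x *m (P x)^T + U s x *m (U t x)^T +
    (U2 t s x *m (P x)^T + U s x *m (U t x)^T)^T) +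
   S s x *m G x *m S t x) *m G x).
Proof.
have H := has_mxgradM (has_mxgradM has_mxgrad_G (has_mxgrad_S s)) has_mxgrad_G.
have E (g a b d : 'M[R]_n) : (g *m b *m g *m a + g *m d) *m g +
    g *m a *m (g *m b *m g) = g *m (b *m g *m a + d + a *m g *m b) *m g.
  by rewrite !mulmxDr !mulmxDl !mulmxA.
by move=> k l; apply: (has_grad_eq (H k l)) => // t x; rewrite E.
Qed.

(** Differentiating x.Du along k produces an extra u_k that cancels the derivative of -u, so no
    zeroth-order term survives; the right side comes from differentiating g^{st}. *)
Lemma shrinker_diff x k a :
  (mxcontract (G x) (fun s t => U2 s t x) - \sum_s x 0 s *: U s x) k a =
  - \sum_s \sum_t (G x *m S k x *m G x) s t * U s x t a.
Proof.
have HL := has_grad_sum (index_enum 'I_n) (fun i => has_grad_sum (index_enum 'I_n)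
  (fun j => has_gradM (has_mxgrad_G i j) (has_mxgrad_U i j a))).
have HR := has_gradD (has_gradZ (-1) (has_grad_partials [::] (u_smooth a)))
  (has_grad_sum (index_enum 'I_n)
    (fun i => has_gradM (has_grad_coord R i) (has_mxgrad_P i a))).
have E : (fun x => \sum_i \sum_j G x i j * U i x j a) =
    (fun x => -1 * partials [::] (component u a) x + \sum_i x 0 i * P x i a).
  apply/funext => y.
  transitivity (\sum_i \sum_j invmx (graph_metric u y) i j *
      partial i (partial j (component u a)) y).
    by apply: eq_bigr => i _; apply: eq_bigr => j _; rewrite [U _ _ _ _]mxE.
  rewrite shrinker mulN1r; congr (_ + _); apply: eq_bigr => i _.
  by rewrite [P _ _ _]mxE [gradient _ _ _ _]mxE.
have := has_grad_partial k HL; rewrite E (has_grad_partial k HR).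
move=> /(congr1 (@^~ x)) /= {E HL HR} E.
have U2E s t : U2 s t x k a = U2 k s x t a.
  rewrite [LHS]mxE [RHS]mxE -(partials_swap [:: t] s k a).
  exact: (congr1 (fun f => partial s f x) (partials_swap [::] t k a)).
rewrite [LHS]mxE [X in _ + X]mxE.
have -> : (mxcontract (G x) (fun s t => U2 s t x)) k a =
    \sum_s \sum_t G x s t * U2 k s x t a.
  rewrite summxE; apply: eq_bigr => s _; rewrite summxE.
  by apply: eq_bigr => t _; rewrite [LHS]mxE; congr (_ * _); exact: U2E.
have -> : \sum_s \sum_t G x s t * U2 k s x t a =
   (\sum_i \sum_j ((G x *m S k x *m G x) i j * U i x j a + G x i j * U2 k i x j a))
   - \sum_s \sum_t (G x *m S k x *m G x) s t * U s x t a.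
  rewrite -sumrB; apply: eq_bigr => i _; rewrite -sumrB; apply: eq_bigr => j _.
  by rewrite addrAC subrr add0r.
rewrite -E summxE; set A := \sum_s \sum_t _.
have -> : \sum_i (x 0 i *: U i x) k a = \sum_i x 0 i * U k x i a.
  by apply: eq_bigr => i _; rewrite [LHS]mxE; congr (_ * _); exact: U_sym.
rewrite big_split/= (bigD1 k)//= eqxx mul1r big1 => [|i /negbTE]; last first.
  by rewrite eq_sym => ->; rewrite mul0r.
by rewrite [P x k a]mxE /=; ring.
Qed.

(** Since (G X G)_{kk} is the form of X at the k-th row of G, the three contractions become three
    traces, each non-negative. *)
Lemma drift_G x k :
  let r := row k (G x) in
  let Z X := \matrix_(s < n) (r *m X s x) in
  drift_op (G x) x (fun s => (G x *m S s x *m G x) k k) (fun s t =>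
    (G x *m (S t x *m G x *m S s x +
   (U2 t s x *m (P x)^T + U s x *m (U t x)^T +
    (U2 t s x *m (P x)^T + U s x *m (U t x)^T)^T) +
   S s x *m G x *m S t x) *m G x) k k) =
  (\tr (G x *m (Z M *m G x *m (Z M)^T)) +
   \tr (G x *m (Z (fun s x => (M s x)^T) *m G x *m (Z (fun s x => (M s x)^T))^T)) +
   \tr (G x *m ((\matrix_(s < n) (r *m U s x)) *m
     (\matrix_(s < n) (r *m U s x))^T))) *+ 2.
Proof.
move=> r Z.
have U2sym t s : U2 t s x = U2 s t x.
  apply/matrixP => i j; rewrite [LHS]mxE [RHS]mxE.
  exact: (congr1 (@^~ x) (partials_swap [:: i] t s j)).
transitivity ((G x *m (mxcontract (G x) (fun s t => S t x *m G x *m S s x +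
   (U2 s t x *m (P x)^T + U s x *m (U t x)^T +
    (U2 s t x *m (P x)^T + U s x *m (U t x)^T)^T) +
   S s x *m G x *m S t x) - \sum_s x 0 s *: S s x) *m G x) k k).
  rewrite mulmxBr mulmxBl -mxcontract_mull -mxcontract_mulr [RHS]mxE [X in _ + X]mxE.
  congr (_ - _).
    rewrite summxE; apply: eq_bigr => s _; rewrite summxE; apply: eq_bigr => t _.
    by rewrite U2sym [RHS]mxE.
  rewrite mulmx_sumr mulmx_suml summxE; apply: eq_bigr => s _.
  by rewrite -scalemxAr -scalemxAl [RHS]mxE.
rewrite (drift_metric_identity (G_sym x) (fun s k a => U_sym s k a x)
  (shrinker_diff x)).
have GGE A : (G x *m A *m G x) k k = bform A r r.
  by rewrite -bform_delta /bform /r rowE trmx_mul G_sym !mulmxA.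
have BD A B : bform (A + B) r r = bform A r r + bform B r r.
  by rewrite /bform mulmxDr mulmxDl mxE.
rewrite GGE mulr2n BD -mulr2n !BD (bform_mxcontract (G_sym x) _ (fun s => M s x)).
rewrite (bform_mxcontract (G_sym x) _ (fun s => (M s x)^T)).
by rewrite (bform_mxcontract (G_sym x) _ (fun s => U s x)) mulmx1.
Qed.

Lemma hessian_eq0 s x : U s x = 0.
Proof.
(* As k varies these are all the rows of G U_s, and G is invertible. *)
suff H k : row k (G x) *m U s x = 0.
  have GU : G x *m U s x = 0 by apply/row_matrixP => k; rewrite row_mul H row0.
  by rewrite -[U s x](mulKVmx (metric_unit x)) -/(G x) GU mulmx0.
have Hf := has_mxgrad_G k k; have Hf2 s' := has_mxgrad_G2 s' k k.
have tr_ge0 y q (K : 'M[R]_q) Z : psdmx K -> 0 <= \tr (G y *m (Z *m K *m Z^T)).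
  exact/mxtrace_psd_sandwich/G_psd.
have psd1 : psdmx (1%:M : 'M[R]_m).
  split=> [|v]; first exact: tr_scalar_mx.
  by rewrite bform_scalar mul1r dotp_ge0.
have tr1_ge0 y (Z : 'M[R]_(n, m)) : 0 <= \tr (G y *m (Z *m Z^T)).
  by have := tr_ge0 y _ _ Z psd1; rewrite mulmx1.
have Lf y := drift_G y k; rewrite /= in Lf.
have cst y z : G y k k = G z k k.
  have le := drift_subsolution_le Hf Hf2 (fun y => G_diag_le y k)
    (divr_ge0 (ler0n R n) (ltW c0)) G_psd tr_G_le
    (fun y => invmx_form_ge (spacelike y) (metric_le y)).
  have {}le : forall y z, G y k k <= G z k k.
    by apply: le => y'; rewrite Lf mulrn_wge0// !addr_ge0// ?tr_ge0//; exact: G_psd.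
  by apply/eqP; rewrite eq_le !le.
have grad0 (f : 'rV[R]_n -> R) df : has_grad f df -> (forall y z, f y = f z) ->
    forall i y, df i y = 0.
  move=> Hg fc i y; rewrite -(has_grad_partial i Hg).
  rewrite (has_grad_partial i (has_grad_eq (has_grad_cst n (f 0)) _
    (fun i => fun=> erefl)))// => z; exact: fc.
have d1 := grad0 _ _ Hf cst.
have d2 i := grad0 _ _ (Hf2 i) (fun y z => etrans (d1 i y) (esym (d1 i z))).
have := Lf x; rewrite /drift_op.
under eq_bigr => i _ do under eq_bigr => j _ do rewrite d2 mulr0.
rewrite big1 => [|i _]; last by rewrite big1.
rewrite big1 => [|i _]; last by rewrite d1 mulr0.
rewrite subr0; set V := \matrix_s' (row k (G x) *m U s' x).
(* A zero sum of non-negative traces: the last one vanishes, and it is the Gram trace of [V], so [V]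
   is zero by definiteness of G. *)
move/esym/eqP; rewrite mulrn_eq0/= paddr_eq0; last 2 first.
- by rewrite addr_ge0// tr_ge0//; exact: G_psd.
- exact: tr1_ge0.
move=> /andP[_ /eqP V0].
have := mxtrace_gram_eq0 (G_posdef x) V0 => /row_matrixP/(_ s).
by rewrite rowK row0.
Qed.

Lemma shrinker_linear : exists D : 'M[R]_(n, m), forall x, u x = x *m D.
Proof.
exists (P 0) => x.
have Pc y : P y = P 0.
  apply/matrixP => k a; apply: (has_grad0_cst (has_mxgrad_P k a)) => s z.
  by rewrite hessian_eq0 mxE.
apply/rowP => a; have := shrinker x a.
rewrite big1 => [|i _]; last first.
  rewrite big1// => j _; have -> : partial i (partial j (component u a)) x = U i x j a.
    by rewrite mxE.
  by rewrite hessian_eq0 mxE mulr0.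
move/esym/eqP; rewrite addrC subr_eq0 => /eqP ux.
transitivity (component u a x); first by [].
rewrite -ux [RHS]mxE; apply: eq_bigr => i _; rewrite -(Pc x); congr (_ * _).
by rewrite [LHS]mxE [RHS]mxE.
Qed.

End shrinker.

Unset Implicit Arguments.
Set Strict Implicit.

Theorem proposition20 (R : realType) (n m : nat)
    (n_ge1 : (1 <= n)%N) (m_ge1 : (1 <= m)%N)
    (u : 'rV[R]_n -> 'rV[R]_m)
    (u_smooth : smooth_map u)
    (spacelike : forall x : 'rV[R]_n, posdefmx (graph_metric u x))
    (shrinker : forall (x : 'rV[R]_n) (a : 'I_m),
      \sum_(i < n) \sum_(j < n)
        invmx (graph_metric u x) i j * partial i (partial j (component u a)) x
      = - component u a x + dotp x (gradient (component u a) x))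
    (eigen_lb : exists2 c : R, 0 < c &
      forall (x : 'rV[R]_n) (l : R), eigenvalue (graph_metric u x) l -> c <= l) :
  exists W : {vspace 'rV[R]_(n + m)}, graph_of u = [set` W].
Proof.
have [c c0 eig] := eigen_lb.
have [D ulin] := shrinker_linear n_ge1 u_smooth spacelike shrinker c0 eig.
pose L : 'Hom('rV[R]_n, 'rV[R]_(n + m)) := linfun (mulmxr (row_mx 1%:M D)).
have LE x : L x = row_mx x (u x) by rewrite lfunE/= mul_mx_row mulmx1 -ulin.
exists (limg L); apply/seteqP; split=> [_ [x _ <-]|w]/=.
  by rewrite -LE memv_img// memvf.
by move=> /memv_imgP[x _ ->]; exists x.
Qed.
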